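(* Let $n\ge 1$ and $k\ge 1$ be integers, let $I=[0,1]$, let $c_1,c_2\in C^k(I,\mathbb{R}^n)$, and let $\lambda_1,\dots,\lambda_k>0$. A curve $g\in H^2(I,O(n))$ is a critical point of the energy functional $$E[g;c_1,c_2]=\frac12\int_I\Big(\|g(s)\cdot j^{1,k}_s c_1-j^{1,k}_s c_2\|_L^2+\|g(s)^{-1}g'(s)\|_{\mathfrak{o}(n)}^2\Big)\,ds$$ if and only if $\Omega(s)=g(s)^{-1}g'(s)$ satisfies the equation $$\Omega'(s)=\big(g(s)^{-1}j^{1,k}_s c_2\big)\diamond\big(j^{1,k}_s c_1\big)^\flat$$ with boundary conditions $\Omega(0)=\Omega(1)=0$.
   Context: $O(n)$ is the orthogonal group of real $n\times n$ matrices and $\mathfrak{o}(n)$ is its Lie algebra of antisymmetric matrices, with inner product $\langle\Omega,\Omega'\rangle_{\mathfrak{o}(n)}=\operatorname{tr}(\Omega^T\Omega')=-\operatorname{tr}(\Omega\Omega')$ and induced norm $\|\cdot\|_{\mathfrak{o}(n)}$. This inner product is used to identify the dual $\mathfrak{o}(n)^*$ with $\mathfrak{o}(n)$. For $c\in C^k(I,\mathbb{R}^n)$ and $s\in I$, $j^{1,k}_s c$ is the $n\times k$ matrix whose $i$-th column is $c^{(i)}(s)$, $i=1,\dots,k$. Let $V$ be the space of real $n\times k$ matrices; $O(n)$ acts on $V$ by left multiplication $g\cdot A=gA$. Put $L=\operatorname{diag}(\lambda_1,\dots,\lambda_k)$ and $\langle A,B\rangle_L=\operatorname{tr}(LA^TB)$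 on $V$, with induced norm $\|\cdot\|_L$. The map $\flat:V\to V^*$ is the one induced by this inner product: $\langle B^\flat,A\rangle=\langle B,A\rangle_L$. Diamond operator: for $A,B\in V$, $A\diamond B^\flat\in\mathfrak{o}(n)^*\cong\mathfrak{o}(n)$ is defined by $\langle A\diamond B^\flat,\Omega\rangle=\langle B^\flat,\Omega A\rangle=\operatorname{tr}(LB^T\Omega A)$ for all $\Omega\in\mathfrak{o}(n)$. Under the identification $\mathfrak{o}(n)^*\cong\mathfrak{o}(n)$ given by the inner product, $A\diamond B^\flat$ is thus the unique $X\in\mathfrak{o}(n)$ with $\langle X,\Omega\rangle_{\mathfrak{o}(n)}=\operatorname{tr}(LB^T\Omega A)$ for all $\Omega\in\mathfrak{o}(n)$. $H^2(I,O(n))$ is the space of curves $g:I\to O(n)$ of Sobolev class $H^2$ (two square-integrable derivatives); the differential equation is understood as an equality of $L^2$ functions. A curve $g\in H^2(I,O(n))$ is a critical point of $E$ if $\frac{d}{d\epsilon}\big|_{\epsilon=0}E[g_\epsilon;c_1,c_2]=0$ for every family of curves $g_\epsilon\in H^2(I,O(n))$ depending smoothly on $\epsilon$ in a neighborhood of $0$ with $g_0=g$ (the endpoints $g_\epsilon(0)$, $g_\epsilon(1)$ are free). *)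

(* Defs.v *)
From HB Require Import structures.
From mathcomp Require Import all_boot all_order all_algebra.
From mathcomp Require Import all_classical all_reals all_analysis.

Set Implicit Arguments.
Unset Strict Implicit.
Unset Printing Implicit Defensive.

Import Order.TTheory GRing.Theory Num.Theory numFieldNormedType.Exports.

Local Open Scope classical_set_scope.
Local Open Scope ring_scope.

(* Curves on I = [0, 1] are total functions on R of which only the values on
   I matter: every notion below depends only on the restriction to I.
   Vector- and matrix-valued curves are treated entrywise. *)

Section scalar_curves.
Context {R : realType}.
Implicit Types f v : R -> R.

Definition unitI : set R := `[0%R, 1%R].

Definition slope f (s t : R) : R := (t - s)^-1 * (f t - f s).

(* The limit is taken inside I, hence one-sided at the two endpoints. *)
Definition derivableI f (s : R) : Prop :=
  cvg (slope f s t @[t --> within unitI s^']).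

Definition derivI f (s : R) : R :=
  lim (slope f s t @[t --> within unitI s^']).

Definition CkI (k : nat) f : Prop :=
  (forall i s, (i < k)%N -> unitI s -> derivableI (iter i derivI f) s) /\
  (forall i, (i <= k)%N -> {within unitI, continuous (iter i derivI f)}).

Definition L2I v : Prop :=
  measurable_fun unitI v /\
  lebesgue_measure.-integrable unitI (fun s => (v s ^+ 2)%:E).

(* f is absolutely continuous on I, with square-integrable derivative v. *)
Definition is_L2_deriv f v : Prop :=
  L2I v /\
  forall t, unitI t -> f t = f 0 + \int[lebesgue_measure]_(s in `[0, t]) v s.

(* A representative of the class (modulo a.e. equality) of L2 derivatives. *)
Definition L2_deriv f : R -> R := xget (cst 0) [set v | is_L2_deriv f v].

Definition H2 f : Prop := CkI 1 f /\ exists v, is_L2_deriv (derivI f) v.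

Definition H2_sqnorm f : R :=
  \int[lebesgue_measure]_(s in unitI)
    (f s ^+ 2 + derivI f s ^+ 2 + L2_deriv (derivI f) s ^+ 2).

End scalar_curves.

Section matrix_curves.
Context {R : realType} {m n : nat}.
Implicit Types g W : R -> 'M[R]_(m, n).

Definition derivI_mx g (s : R) : 'M[R]_(m, n) :=
  \matrix_(i, j) derivI (fun t => g t i j) s.

Definition CkI_mx (k : nat) g : Prop := forall i j, CkI k (fun t => g t i j).

Definition is_L2_deriv_mx g W : Prop :=
  forall i j, is_L2_deriv (fun t => g t i j) (fun t => W t i j).

Definition H2_mx g : Prop := forall i j, H2 (fun t => g t i j).

Definition H2_norm g : R :=
  Num.sqrt (\sum_i \sum_j H2_sqnorm (fun t => g t i j)).

(* e |-> G e is a C^oo map from ]-delta, delta[ to the Hilbert space H^2: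
   D j is its j-th derivative, a limit of difference quotients in H^2 norm. *)
Definition smooth_H2_family (delta : R) (G : R -> R -> 'M[R]_(m, n)) : Prop :=
  exists D : nat -> R -> R -> 'M[R]_(m, n),
    D 0%N = G /\
    forall j e, `|e| < delta ->
      H2_mx (D j e) /\
      H2_norm (fun s => h^-1 *: (D j (e + h) s - D j e s) - D j.+1 e s)
        @[h --> (0 : R)^'] --> (0 : R).

End matrix_curves.

Section orthogonal.
Context {R : realType} {n : nat}.

Definition orthogonal_mx (A : 'M[R]_n) : Prop := A^T *m A = 1%:M.

Definition antisymmetric_mx (X : 'M[R]_n) : Prop := X^T = - X.

Definition ip_o (X Y : 'M[R]_n) : R := \tr (X^T *m Y).

Definition norm_o (X : 'M[R]_n) : R := Num.sqrt (ip_o X X).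

Definition H2_O (g : R -> 'M[R]_n) : Prop :=
  H2_mx g /\ forall s, unitI s -> orthogonal_mx (g s).

Definition log_deriv (g : R -> 'M[R]_n) (s : R) : 'M[R]_n :=
  invmx (g s) *m derivI_mx g s.

End orthogonal.

Section diamond.
Context {R : realType} {n k : nat}.
Implicit Types (A B : 'M[R]_(n, k)) (lam : 'rV[R]_k).

Definition ip_L lam A B : R := \tr (diag_mx lam *m A^T *m B).

Definition norm_L lam A : R := Num.sqrt (ip_L lam A A).

Definition flat lam B : 'M[R]_(n, k) -> R := fun A => ip_L lam B A.

Fact flat_is_scalar lam B : scalar (flat lam B).
Proof.
by move=> a A A'; rewrite /flat /ip_L mulmxDr -scalemxAr mxtraceD mxtraceZ.
Qed.

HB.instance Definition _ lam B :=
  GRing.isLinear.Build R 'M[R]_(n, k) R *%R (flat lam B) (flat_is_scalar lam B).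

(* The value is in o(n)^*, identified with o(n) through ip_o; it exists and is
   unique by is_diamond_ex and is_diamond_uniq below. *)
Definition is_diamond A (phi : {scalar 'M[R]_(n, k)}) (X : 'M[R]_n) : Prop :=
  antisymmetric_mx X /\
  forall Om : 'M[R]_n, antisymmetric_mx Om -> ip_o X Om = phi (Om *m A).

Definition diamond A (phi : {scalar 'M[R]_(n, k)}) : 'M[R]_n :=
  xget 0 [set X | is_diamond A phi X].

Lemma ip_oE (X Y : 'M[R]_n) : ip_o X Y = \sum_i \sum_j X i j * Y i j.
Proof.
rewrite /ip_o /mxtrace exchange_big; apply: eq_bigr => i _.
by rewrite !mxE; apply: eq_bigr => j _; rewrite !mxE.
Qed.

Lemma is_diamond_uniq A phi X Y :
  is_diamond A phi X -> is_diamond A phi Y -> X = Y.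
Proof.
move=> [aX XP] [aY YP]; set Z := X - Y.
have aZ : antisymmetric_mx Z.
  by rewrite /antisymmetric_mx /Z linearB /= aX aY opprB opprK addrC.
have : ip_o Z Z = 0.
  have -> : ip_o Z Z = ip_o X Z - ip_o Y Z.
    by rewrite /ip_o -linearB /= -mulmxBl -linearB.
  by rewrite XP// YP// subrr.
rewrite ip_oE => Z0; apply/eqP; rewrite -subr_eq0 -/Z; apply/eqP/matrixP => i j.
have Zi : \sum_j' Z i j' * Z i j' = 0.
  by apply: (psumr_eq0P _ Z0) => // i' _; apply: sumr_ge0 => j' _; rewrite -expr2 sqr_ge0.
have Zij : Z i j * Z i j = 0.
  by apply: (psumr_eq0P _ Zi) => // j' _; rewrite -expr2 sqr_ge0.
by move/eqP: Zij; rewrite mulf_eq0 orbb => /eqP ->; rewrite mxE.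
Qed.

Lemma is_diamond_ex A phi : exists X, is_diamond A phi X.
Proof.
pose F i j : R := phi (delta_mx i j *m A).
exists (\matrix_(i, j) (2^-1 * (F i j - F j i))); split.
  by apply/matrixP => i j; rewrite !mxE -mulrN opprB.
move=> Om aOm; rewrite ip_oE.
have aOmE i j : Om j i = - Om i j.
  by have /matrixP/(_ i j) := aOm; rewrite !mxE.
have -> : phi (Om *m A) = \sum_i \sum_j Om i j * F i j.
  rewrite {1}(matrix_sum_delta Om) mulmx_suml linear_sum; apply: eq_bigr => i _.
  rewrite mulmx_suml linear_sum; apply: eq_bigr => j _.
  by rewrite -scalemxAl linearZ.
set S := RHS.
have S' : \sum_i \sum_j Om i j * F j i = - S.
  rewrite exchange_big /S -sumrN; apply: eq_bigr => i _.
  by rewrite -sumrN; apply: eq_bigr => j _; rewrite aOmE mulNr.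
transitivity (2^-1 * (S - \sum_i \sum_j Om i j * F j i)).
  rewrite -sumrB mulr_sumr; apply: eq_bigr => i _.
  rewrite -sumrB mulr_sumr; apply: eq_bigr => j _.
  by rewrite !mxE -mulrA; congr (_ * _); rewrite mulrC mulrBr.
by rewrite S' opprK -mulr2n -[S *+ 2]mulr_natl mulKf // pnatr_eq0.
Qed.

Lemma diamondP A phi : is_diamond A phi (diamond A phi).
Proof. by apply: (xgetPex 0); exact: is_diamond_ex. Qed.

End diamond.

Section energy.
Context {R : realType} {n k : nat}.
Implicit Types (lam : 'rV[R]_k) (c : R -> 'cV[R]_n) (g : R -> 'M[R]_n).

(* Column i of the jet, i = 0, ..., k - 1, is the derivative of order i + 1. *)
Definition jet c (s : R) : 'M[R]_(n, k) :=
  \matrix_(a, i) iter i.+1 derivI (fun t => c t a 0) s.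

Definition energy lam c1 c2 g : R :=
  2^-1 * \int[lebesgue_measure]_(s in unitI)
    (norm_L lam (g s *m jet c1 s - jet c2 s) ^+ 2 + norm_o (log_deriv g s) ^+ 2).

Definition critical_point lam c1 c2 g : Prop :=
  forall (delta : R) (G : R -> R -> 'M[R]_n),
    0 < delta ->
    (forall e, `|e| < delta -> H2_O (G e)) ->
    smooth_H2_family delta G ->
    (forall s, unitI s -> G 0 s = g s) ->
    is_derive (0 : R) (1 : R) (fun e : R => energy lam c1 c2 (G e)) (0 : R).

End energy.

(* Main.v *)
Require Import Defs.
From mathcomp Require Import all_boot all_order all_algebra.
From mathcomp Require Import all_classical all_reals all_analysis.
From mathcomp Require Import measurable_realfun ring lra.
Import Order.TTheory GRing.Theory Num.Theory numFieldNormedType.Exports.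
Local Open Scope classical_set_scope.
Local Open Scope ring_scope.

(** On O(n) the norm of g^-1 g' is that of g', so the energy is the restriction
    to O(n)-valued curves of a quadratic functional of g on H2
    (energy_quadratic).  Hence along an H2-smooth family through g its derivative
    is a bounded linear form energy1 g U of the velocity U of the family
    (energy_is_derive), and this velocity is tangent to O(n): U = g X with X
    antisymmetric (family_tangent).  Let Om = g^-1 g' and let F be the right-hand
    side of the differential equation.  Substituting U = g X, every term that
    pairs a symmetric with an antisymmetric matrix vanishes, and what remains is
    the integral of <F, X> + <Om, X'> (density1_tangent).

    If Om' = F and Om vanishes at both endpoints, the integrand is the derivative
    of <Om, X>, so the integral is zero (euler_lagrange_critical).

    Conversely, it suffices to test with X = phi K, for scalar H2 functions phi
    and for K the difference of two transposed matrix units.  These velocities are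
    realized by the curves g exp(e phi K).  As K^3 = - K, the exponential is
    1 + sin(e phi) K + (1 - cos(e phi)) K^2, and smoothness of the family in H2
    reduces to Taylor estimates on the sine that are uniform on bounded sets
    (rot_smooth).  Criticality then says that the integral of
    F_ij phi + Om_ij phi' vanishes for all phi, which is the weak form of Om' = F
    together with its natural boundary conditions (du_bois_reymond).

    Both directions integrate by parts with functions that are only absolutely
    continuous; the product rule for these is is_L2_derivM. *)

Set Implicit Arguments.
Unset Strict Implicit.

Local Notation mu := lebesgue_measure.
Local Notation contI f := {within unitI, continuous f}.

(** * Continuous functions on the unit interval *)

Section continuous_on_unitI.
Context {R : realType}.
Implicit Types (f u v w : R -> R) (s t : R).

(** The type annotation selects the measurable structure that carries the
    Lebesgue measure; the one inferred by default for R is another instance. *)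
Lemma measurable_unitI : measurable (unitI : set (measurableTypeR R)).
Proof. exact: measurable_itv. Qed.

Lemma measurable_oc (a b : R) : measurable (`]a, b] : set (measurableTypeR R)).
Proof. exact: measurable_itv. Qed.

Lemma unitI0 : unitI (0 : R).
Proof. by rewrite /unitI /= in_itv /= lexx ler01. Qed.

Lemma unitI1 : unitI (1 : R).
Proof. by rewrite /unitI /= in_itv /= lexx ler01. Qed.

Lemma contIP f : contI f <->
  forall s, unitI s -> f t @[t --> within unitI (nbhs s)] --> f s.
Proof. exact: subspace_continuousP. Qed.

Lemma contI_eq f u : (forall s, unitI s -> f s = u s) -> contI f -> contI u.
Proof.
by move=> fu; apply: subspace_eq_continuous => s; rewrite inE => /fu.
Qed.

Lemma contI_cst a : contI (fun _ : R => a : R).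
Proof. by apply/contIP => s _; exact: cvg_cst. Qed.

Lemma contID f u : contI f -> contI u -> contI (fun s => f s + u s).
Proof.
by move=> /contIP cf /contIP cu; apply/contIP => s Is; apply: cvgD; auto.
Qed.

Lemma contIM f u : contI f -> contI u -> contI (fun s => f s * u s).
Proof.
by move=> /contIP cf /contIP cu; apply/contIP => s Is; apply: cvgM; auto.
Qed.

Lemma contIN f : contI f -> contI (fun s => - f s).
Proof. by move=> /contIP cf; apply/contIP => s Is; apply: cvgN; auto. Qed.

Lemma contIB f u : contI f -> contI u -> contI (fun s => f s - u s).
Proof. by move=> cf cu; apply: contID => //; exact: contIN. Qed.

Lemma contIX f n : contI f -> contI (fun s => f s ^+ n).
Proof.
move=> cf; elim: n => [|n IH].
  by under eq_fun do rewrite expr0; exact: contI_cst.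
by under eq_fun do rewrite exprS; exact: contIM.
Qed.

Lemma contI_abs f : contI f -> contI (fun s => `|f s|).
Proof. by move=> /contIP cf; apply/contIP => s Is; apply: cvg_norm; auto. Qed.

Lemma contI_comp (h : R -> R) f :
  continuous h -> contI f -> contI (fun s => h (f s)).
Proof.
move=> ch /contIP cf; apply/contIP => s Is.
by apply: continuous_cvg; [exact: ch|exact: cf].
Qed.

Lemma contI_sum (J : Type) (r : seq J) (F : J -> R -> R) :
  (forall j, contI (F j)) -> contI (fun s => \sum_(j <- r) F j s).
Proof.
move=> cF; elim: r => [|j r IH].
  by under eq_fun do rewrite big_nil; exact: contI_cst.
by under eq_fun do rewrite big_cons; exact: contID.
Qed.

Lemma contI_bounded f : contI f ->
  exists2 M, 0 < M & forall s, unitI s -> `|f s| <= M.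
Proof.
move=> cf.
have [M [Mr HM]] : bounded_set (f @` unitI).
  by apply: compact_bounded; apply: continuous_compact => //; exact: segment_compact.
exists (`|M| + 1) => [|s Is]; first by rewrite ltr_wpDl.
by apply: HM; [rewrite (le_lt_trans (ler_norm _))// ltrDl|exists s].
Qed.

(** * Integrals over the unit interval *)

Definition L1I f := mu.-integrable unitI (EFin \o f).

Lemma contI_meas f : contI f -> measurable_fun unitI f.
Proof. by apply: subspace_continuous_measurable_fun; exact: measurable_itv. Qed.

Lemma contI_L1 f : contI f -> L1I f.
Proof. by apply: continuous_compact_integrable; exact: segment_compact. Qed.

Lemma L1I_meas f : L1I f -> measurable_fun unitI f.
Proof. by move=> /integrableP[/measurable_EFinP]. Qed.

Lemma L1I_eq f u : (forall s, unitI s -> f s = u s) -> L1I f -> L1I u.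
Proof.
move=> fu; apply: eq_integrable; first exact: measurable_unitI.
by move=> s; rewrite inE /= => /fu ->.
Qed.

Lemma L1ID f u : L1I f -> L1I u -> L1I (fun s => f s + u s).
Proof. by move=> lf lu; exact: (integrableD measurable_unitI lf lu). Qed.

Lemma L1IZ a f : L1I f -> L1I (fun s => a * f s).
Proof. by move=> lf; apply: (integrableZl measurable_unitI a lf). Qed.

Lemma L1I_abs f : L1I f -> L1I (fun s => `|f s|).
Proof. by move=> lf; apply: (integrable_norm lf). Qed.

Lemma L1I_dominated f u : measurable_fun unitI f -> L1I u ->
  (forall s, unitI s -> `|f s| <= u s) -> L1I f.
Proof.
move=> mf lu fu; apply: (le_integrable measurable_unitI _ _ lu).
  exact/measurable_EFinP.
move=> s Is; rewrite /= lee_fin (le_trans (fu s Is))//; exact: ler_norm.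
Qed.

Lemma L1I_sub f t : unitI t -> L1I f ->
  mu.-integrable `[0, t] (EFin \o f).
Proof.
rewrite /unitI /= in_itv/= => /andP[t0 t1]; apply: integrableS;
  [exact: measurable_itv|exact: measurable_itv|].
by apply: subset_itvl; rewrite bnd_simp.
Qed.

Lemma L1I_sub2 f a b : unitI a -> unitI b -> L1I f ->
  mu.-integrable `]a, b] (EFin \o f).
Proof.
rewrite /unitI /= !in_itv/= => /andP[a0 _] /andP[_ b1]; apply: integrableS;
  [exact: measurable_itv|exact: measurable_itv|].
by apply: subset_itv; rewrite bnd_simp.
Qed.

Lemma Rint_eq f u : (forall s, unitI s -> f s = u s) ->
  \int[mu]_(s in unitI) f s = \int[mu]_(s in unitI) u s.
Proof. by move=> fu; apply: eq_Rintegral => s; rewrite inE => /fu. Qed.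

Lemma RintD f u : L1I f -> L1I u ->
  \int[mu]_(s in unitI) (f s + u s) =
  \int[mu]_(s in unitI) f s + \int[mu]_(s in unitI) u s.
Proof. exact: RintegralD measurable_unitI. Qed.

Lemma RintB f u : L1I f -> L1I u ->
  \int[mu]_(s in unitI) (f s - u s) =
  \int[mu]_(s in unitI) f s - \int[mu]_(s in unitI) u s.
Proof. exact: RintegralB measurable_unitI. Qed.

Lemma RintZ a f : L1I f ->
  \int[mu]_(s in unitI) (a * f s) = a * \int[mu]_(s in unitI) f s.
Proof. exact: RintegralZl measurable_unitI. Qed.

Lemma Rint_le f u : L1I f -> L1I u -> (forall s, unitI s -> f s <= u s) ->
  \int[mu]_(s in unitI) f s <= \int[mu]_(s in unitI) u s.
Proof. exact: le_Rintegral measurable_unitI. Qed.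

Lemma Rint_cst a : \int[mu]_(s in unitI) (a : R) = a.
Proof.
rewrite Rintegral_cst; last exact: measurable_unitI.
by rewrite /unitI/= lebesgue_measure_itv/= lte_fin ltr01/= subr0 mulr1.
Qed.

Lemma Rint_sum (J : Type) (r : seq J) (F : J -> R -> R) :
  (forall j, L1I (F j)) ->
  L1I (fun s => \sum_(j <- r) F j s) /\
  \int[mu]_(s in unitI) (\sum_(j <- r) F j s) =
  \sum_(j <- r) \int[mu]_(s in unitI) F j s.
Proof.
move=> lF; elim: r => [|j r [IHl IHi]]; split.
- apply: (@L1I_eq (fun=> 0)); last exact/contI_L1/contI_cst.
  by move=> s _; rewrite big_nil.
- by under eq_Rintegral do rewrite big_nil; rewrite big_nil; exact: Rint_cst.
- apply: (@L1I_eq (fun s => F j s + \sum_(j' <- r) F j' s)); last exact: L1ID.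
  by move=> s _; rewrite big_cons.
- by rewrite big_cons -IHi -RintD//; apply: Rint_eq => s _; rewrite big_cons.
Qed.

End continuous_on_unitI.

(** * Square-integrable derivatives *)

Section L2_derivatives.
Context {R : realType}.
Implicit Types (f u v w : R -> R) (s t : R).

Lemma L2I_sqr v : L2I v -> L1I (fun s => v s ^+ 2).
Proof. by case. Qed.

Lemma L2I_dominated f v : measurable_fun unitI f -> L2I v ->
  (forall s, unitI s -> `|f s| <= `|v s|) -> L2I f.
Proof.
move=> mf lv fv; split=> //.
apply: (L1I_dominated (u := fun s => v s ^+ 2)) => //.
- exact: measurable_funX.
- exact: L2I_sqr.
- move=> s Is; rewrite normrX -[leRHS]real_normK ?num_real//.
  by rewrite lerXn2r ?nnegrE// fv.
Qed.

Lemma L2I_L1 v : L2I v -> L1I v.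
Proof.
move=> [mv v2]; apply: (L1I_dominated (u := fun s => 1 + v s ^+ 2)) => //.
  by apply: L1ID => //; exact/contI_L1/contI_cst.
move=> s _; rewrite -[v s ^+ 2]real_normK ?num_real//.
by have := sqr_ge0 (`|v s| - 1); have := normr_ge0 (v s); nra.
Qed.

Lemma contI_L2 f : contI f -> L2I f.
Proof.
move=> cf; split; first exact: contI_meas.
by apply: contI_L1; exact: contIX.
Qed.

Lemma L2I_eq f u : (forall s, unitI s -> f s = u s) -> L2I f -> L2I u.
Proof.
move=> fu [mf f2]; split.
  by apply: eq_measurable_fun mf => s; rewrite inE => /fu.
by move: f2; apply: L1I_eq => s /fu ->.
Qed.

Lemma L2IZ a v : L2I v -> L2I (fun s => a * v s).
Proof.
move=> [mv v2]; split; first exact: measurable_funM.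
have := L1IZ (a ^+ 2) v2.
by apply: L1I_eq => s _; rewrite exprMn.
Qed.

Lemma L2ID f u : L2I f -> L2I u -> L2I (fun s => f s + u s).
Proof.
move=> [mf f2] [mu' u2]; split; first exact: measurable_funD.
apply: (L1I_dominated (u := fun s => 2 * (f s ^+ 2 + u s ^+ 2))).
- by apply: measurable_funX; exact: measurable_funD.
- by apply: L1IZ; exact: L1ID.
- move=> s _; rewrite ger0_norm ?sqr_ge0//.
  by have := sqr_ge0 (f s - u s); nra.
Qed.

Lemma L2I_abs v : L2I v -> L2I (fun s => `|v s|).
Proof.
move=> lv; apply: (L2I_dominated _ lv); last by move=> s _; rewrite normr_id.
by apply: measurableT_comp => //; case: lv.
Qed.

Lemma L2I_contM f v : contI f -> L2I v -> L2I (fun s => f s * v s).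
Proof.
move=> cf lv; have [M M0 fM] := contI_bounded cf.
apply: (L2I_dominated _ (L2IZ M lv)).
  by apply: measurable_funM; [exact: contI_meas|case: lv].
by move=> s Is; rewrite !normrM ler_wpM2r// (le_trans (fM s Is))// ler_norm.
Qed.

Lemma is_L2_deriv_L2 f v : is_L2_deriv f v -> L2I v.
Proof. by case. Qed.

Lemma is_L2_deriv_eq f v f' v' : (forall s, unitI s -> f s = f' s) ->
  (forall s, unitI s -> v s = v' s) -> is_L2_deriv f v -> is_L2_deriv f' v'.
Proof.
move=> ff' vv' [lv fv]; split; first exact: (L2I_eq vv' lv).
move=> t It; rewrite -ff'// -ff'; last exact: unitI0.
rewrite fv//; congr (_ + _); apply: eq_Rintegral => s; rewrite inE/= => ts.
apply: vv'; move: It ts; rewrite /unitI/= !in_itv/=; lra.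
Qed.

Lemma is_L2_derivD f v f' v' : is_L2_deriv f v -> is_L2_deriv f' v' ->
  is_L2_deriv (fun s => f s + f' s) (fun s => v s + v' s).
Proof.
move=> [lv fv] [lv' fv']; split; first exact: L2ID.
move=> t It; rewrite fv// fv'// RintegralD//; first by rewrite addrACA.
- exact: (L1I_sub It (L2I_L1 lv)).
- exact: (L1I_sub It (L2I_L1 lv')).
Qed.

Lemma is_L2_derivZ a f v : is_L2_deriv f v ->
  is_L2_deriv (fun s => a * f s) (fun s => a * v s).
Proof.
move=> [lv fv]; split; first exact: L2IZ.
move=> t It; rewrite fv// RintegralZl//; first by rewrite mulrDr.
exact: (L1I_sub It (L2I_L1 lv)).
Qed.

Lemma is_L2_deriv_cst a : is_L2_deriv (fun _ : R => a : R) (fun=> 0).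
Proof.
split; first exact/contI_L2/contI_cst.
by move=> t It; rewrite Rintegral_cst// mul0r addr0.
Qed.

Lemma is_L2_deriv_sum (J : Type) (r : seq J) (F V : J -> R -> R) :
  (forall j, is_L2_deriv (F j) (V j)) ->
  is_L2_deriv (fun s => \sum_(j <- r) F j s) (fun s => \sum_(j <- r) V j s).
Proof.
move=> FV; elim: r => [|j r IH].
  under eq_fun do rewrite big_nil; under [X in is_L2_deriv _ X]eq_fun do rewrite big_nil.
  exact: is_L2_deriv_cst.
under eq_fun do rewrite big_cons; under [X in is_L2_deriv _ X]eq_fun do rewrite big_cons.
exact: is_L2_derivD.
Qed.

Lemma is_L2_deriv_int v : L2I v ->
  is_L2_deriv (fun t => \int[mu]_(s in `[0, t]) v s) v.
Proof.
move=> lv; split=> // t _.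
by rewrite set_itv1 Rintegral_set1 add0r.
Qed.

Lemma is_L2_deriv_incr f v a b : is_L2_deriv f v -> unitI a -> unitI b ->
  a <= b -> f b - f a = \int[mu]_(s in `]a, b]) v s.
Proof.
move=> [lv fv] Ia Ib ab; rewrite fv// [f a]fv//.
have iv := L1I_sub Ib (L2I_L1 lv).
have a0 : (BLeft 0 <= BRight a)%O.
  by move: Ia; rewrite bnd_simp/unitI/= in_itv/= => /andP[].
by rewrite -(Rintegral_itvB iv a0) ?bnd_simp// opprD addrACA subrr add0r.
Qed.

Lemma is_L2_deriv_cont f v : is_L2_deriv f v -> contI f.
Proof.
move=> [lv fv].
apply: (@contI_eq _ (fun t => f 0 + parameterized_integral mu 0 t v)).
  by move=> s /fv ->.
apply: contID; first exact: contI_cst.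
by apply: parameterized_integral_continuous => //; exact: L2I_L1.
Qed.

(** The integral of a function is uniformly continuous in its endpoints, as the
    integral over a set of small measure is small. *)
Lemma is_L2_deriv_unif f v e : is_L2_deriv f v -> 0 < e ->
  exists2 d, 0 < d & forall a b, unitI a -> unitI b -> a <= b -> b - a < d ->
    `|f b - f a| <= e.
Proof.
move=> fv e0; have lv := L2I_L1 (is_L2_deriv_L2 fv).
have lv' : mu.-integrable setT (EFin \o v \_ unitI).
  by rewrite -restrict_EFin; apply/integrable_restrict => //=;
    [exact: measurable_unitI|rewrite setTI].
have [d [d0 dP]] := integral_normr_continuous lv' e0.
exists d => // a b Ia Ib ab bad.
have subI : `]a, b] `<=` unitI.
  by move: Ia Ib; rewrite /unitI/= !in_itv/= => /andP[a0 _] /andP[_ b1];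
    apply: subset_itv; rewrite bnd_simp.
rewrite (is_L2_deriv_incr fv)//.
apply: (le_trans (le_normr_Rintegral _ _)) => //; first exact: L1I_sub2.
have /dP /(_ _) /ltW : measurable `]a, b] by [].
rewrite (_ : \int[mu]_(x in `]a, b]) `|(v \_ unitI) x| =
  \int[mu]_(t in `]a, b]) `|v t|); last first.
  by apply: eq_Rintegral => s; rewrite inE => /subI sI; rewrite patchE mem_set.
apply; rewrite /= lebesgue_measure_itv/=; case: ifPn => _.
  by rewrite -EFinD lte_fin.
by rewrite lte_fin.
Qed.

(** On each piece of a fine subdivision of [0, t], the product rule holds up to
    e times the integral of |v| + |w| over the piece, because f and u vary there by
    at most e; these errors add up to at most e times a constant. *)
Lemma is_L2_derivM f v u w : is_L2_deriv f v -> is_L2_deriv u w ->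
  is_L2_deriv (fun s => f s * u s) (fun s => v s * u s + f s * w s).
Proof.
move=> fv uw; have cf := is_L2_deriv_cont fv; have cu := is_L2_deriv_cont uw.
have lv := is_L2_deriv_L2 fv; have lw := is_L2_deriv_L2 uw.
have lz : L2I (fun s => v s * u s + f s * w s).
  apply: L2ID; last exact: L2I_contM.
  by under eq_fun do rewrite mulrC; exact: L2I_contM.
split=> // t It.
pose z s := v s * u s + f s * w s; pose m s := `|v s| + `|w s|.
have lm : L2I m by apply: L2ID; exact: L2I_abs.
have zP := is_L2_deriv_int lz; have mP := is_L2_deriv_int lm.
set Z := fun _ => _ in zP; set M := fun _ => _ in mP.
pose Err s := f s * u s - Z s.
suff Ee e : 0 < e -> `|Err t - Err 0| <= e * (M t - M 0).
  have : Err t - Err 0 = 0.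
    apply/eqP; rewrite -normr_le0; apply/ler_addgt0Pr => e e0; rewrite add0r.
    have M0 : 0 <= M t - M 0.
      rewrite /M set_itv1 Rintegral_set1 subr0; apply: Rintegral_ge0 => s _.
      by rewrite addr_ge0.
    (* the + 1 is for the case where M is constant *)
    have /Ee : 0 < e / (M t - M 0 + 1) by rewrite divr_gt0// ltr_wpDl.
    move=> /le_trans; apply; rewrite mulrAC ler_pdivrMr ?ltr_wpDl// ler_pM2l//.
    by rewrite lerDl.
  rewrite /Err /Z set_itv1 Rintegral_set1 subr0 => /eqP.
  by rewrite subr_eq0 subr_eq => /eqP.
move=> e0.
have [d1 d10 d1P] := is_L2_deriv_unif fv e0.
have [d2 d20 d2P] := is_L2_deriv_unif uw e0.
(* f b u b - f a u a = (f b - f a) u b + f a (u b - u a): freezing u at the right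
   endpoint and f at the left one leaves no quadratic term. *)
have piece a b : unitI a -> unitI b -> a <= b -> b - a < Num.min d1 d2 ->
    `|Err b - Err a| <= e * (M b - M a).
  move=> Ia Ib ab; rewrite lt_min => /andP[bd1 bd2].
  have inI s : `]a, b]%classic s -> [/\ unitI s, a <= s & s <= b].
    move: Ia Ib; rewrite /unitI /= !in_itv/= => ? ? ?; split; lra.
  have iv := L1I_sub2 Ia Ib (L2I_L1 lv); have iw := L1I_sub2 Ia Ib (L2I_L1 lw).
  have iz := L1I_sub2 Ia Ib (L2I_L1 lz); have im := L1I_sub2 Ia Ib (L2I_L1 lm).
  have ivu : mu.-integrable `]a, b] (EFin \o (fun s => u b * v s)).
    exact: (integrableZl _ (u b) iv).
  have ifw : mu.-integrable `]a, b] (EFin \o (fun s => f a * w s)).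
    exact: (integrableZl _ (f a) iw).
  have ivw : mu.-integrable `]a, b] (EFin \o (fun s => u b * v s + f a * w s)).
    exact: (integrableD (measurable_oc a b) ivu ifw).
  have iD : mu.-integrable `]a, b]
      (EFin \o (fun s => u b * v s + f a * w s - z s)).
    exact: (integrableB (measurable_oc a b) ivw iz).
  have -> : Err b - Err a =
      \int[mu]_(s in `]a, b]) (u b * v s + f a * w s - z s).
    rewrite RintegralB// RintegralD// !RintegralZl// -(is_L2_deriv_incr fv)//.
    rewrite -(is_L2_deriv_incr uw)// -(is_L2_deriv_incr zP)//.
    rewrite /Err; ring.
  rewrite (is_L2_deriv_incr mP)// -RintegralZl//.
  apply: (le_trans (le_normr_Rintegral _ _)) => //.
  apply: le_Rintegral => //.
  - exact: (integrable_norm iD).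
  - exact: (integrableZl _ e im).
  - move=> s /inI[Is as' sb].
    have -> : u b * v s + f a * w s - z s = (u b - u s) * v s - (f s - f a) * w s.
      by rewrite /z; ring.
    rewrite (le_trans (ler_normB _ _))// !normrM mulrDr lerD// ler_wpM2r//.
      by apply: d2P => //; lra.
    by apply: d1P => //; lra.
have [N NP] : exists N : nat, 1 / N.+1%:R < Num.min d1 d2.
  have d12 : 0 < Num.min d1 d2 by rewrite lt_min d10.
  have [N] := ltr_add_invr d12; rewrite add0r => NP.
  by exists N; rewrite div1r.
pose x i := t * i%:R / N.+1%:R.
have xI i : (i <= N.+1)%N -> unitI (x i).
  move=> iN; move: It; rewrite /unitI/= !in_itv/= => /andP[t0 t1].
  rewrite /x divr_ge0 ?mulr_ge0// ler_pdivrMr// mul1r.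
  by rewrite (le_trans (ler_wpM2r _ t1))// mul1r ler_nat.
have step i : (i <= N.+1)%N -> `|Err (x i) - Err 0| <= e * (M (x i) - M 0).
  elim: i => [_|i IH iN]; first by rewrite /x mulr0 mul0r !subrr normr0 mulr0.
  have t01 : 0 <= t <= 1 by move: It; rewrite /unitI /= in_itv.
  have xx : x i.+1 - x i = t / N.+1%:R by rewrite /x -natr1; field.
  have dx : 0 <= t / N.+1%:R <= 1 / N.+1%:R.
    rewrite divr_ge0 ?(andP t01).1//= ler_pM2r ?invr_gt0//; lra.
  have p : `|Err (x i.+1) - Err (x i)| <= e * (M (x i.+1) - M (x i)).
    apply: piece; [exact/xI/ltnW|exact: xI|by rewrite -subr_ge0 xx; case/andP: dx|].
    by rewrite xx; apply: le_lt_trans NP; case/andP: dx.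
  have := IH (ltnW iN); have := ler_normD (Err (x i.+1) - Err (x i)) (Err (x i) - Err 0).
  rewrite addrA subrK; move: p.
  set A := `|Err (x i.+1) - Err (x i)|; set B := `|Err (x i.+1) - Err 0|.
  move=> p q r; have : e * (M (x i.+1) - M 0) =
    e * (M (x i.+1) - M (x i)) + e * (M (x i) - M 0) by ring.
  lra.
by have := step N.+1 (leqnn _); rewrite /x mulfK.
Qed.

End L2_derivatives.

(** * Differentiation on the unit interval *)

Section derivatives_on_unitI.
Context {R : realType}.
Implicit Types (f u v w : R -> R) (s t : R).

Lemma is_derive_cvg (f : R -> R) (s l : R) :
  is_derive s (1 : R) f l <-> h^-1 * (f (h + s) - f s) @[h --> 0^'] --> l.
Proof.
have E : (fun h => h^-1 *: ((f \o shift s) (h *: 1) - f s)) =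
    (fun h => h^-1 * (f (h + s) - f s)).
  by apply/funext => h /=; rewrite [_%:A]mulr1.
split=> [[]|fl].
  by rewrite /derivable /derive E => /cvgP + <-.
split; first by rewrite /derivable E; apply/cvg_ex; exists l.
by rewrite /derive E; apply/cvg_lim => //; exact: Rhausdorff.
Qed.

Lemma is_derive_eps (f : R -> R) (s l : R) :
  is_derive s (1 : R) f l <-> forall e : R, 0 < e -> exists2 d : R, 0 < d &
    forall t, `|t - s| < d -> t != s -> `|l - slope f s t| <= e.
Proof.
rewrite is_derive_cvg; split=> [/cvgrPdist_le fl e /fl|fl].
  rewrite /dnbhs near_withinE => -[d /= d0 dP]; exists d => // t ts tns.
  have := dP (t - s); rewrite /slope subrK; apply; rewrite ?subr_eq0//.
  by rewrite /= sub0r normrN.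
apply/cvgrPdist_le => e /fl[d d0 dP]; rewrite /dnbhs near_withinE.
exists d => //= h; rewrite /ball_/= sub0r normrN => hd h0.
by have := dP (h + s); rewrite /slope addrK -subr_eq0 addrK; apply.
Qed.

Lemma is_derive_continuous (f : R -> R) (s l : R) :
  is_derive s (1 : R) f l -> {for s, continuous f}.
Proof. by move=> [df _]; exact/differentiable_continuous/derivable1_diffP. Qed.

(** The relational form of derivI: a default value of the limit cannot satisfy
    it by accident. *)
Definition has_derivI f s (l : R) := slope f s t @[t --> within unitI s^'] --> l.

(** I has no isolated point: s can be approached from the right if s < 1, and
    from the left otherwise.  One-sided derivatives are unique for this reason. *)
Lemma dnbhsI_proper s : unitI s -> ProperFilter (within unitI s^').
Proof.
move=> Is; apply: Build_ProperFilter_ex => P.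
rewrite /within/= => -[e /= e0 eP].
have [s01] : 0 <= s <= 1 by move: Is; rewrite /unitI/= in_itv.
have [s1|s1] := ltP s 1.
  pose h := Num.min (e / 2) (1 - s).
  have h0 : 0 < h by rewrite lt_min divr_gt0//= subr_gt0.
  exists (s + h); apply: eP => /=.
  - rewrite opprD addNKr normrN gtr0_norm// (@le_lt_trans _ _ (e / 2))//.
      by rewrite ge_min lexx.
    lra.
  - by rewrite gt_eqF// ltrDl.
  - have : h <= 1 - s by rewrite ge_min lexx orbT.
    by rewrite /unitI/= in_itv/= => ?; lra.
pose h := Num.min (e / 2) s.
have h0 : 0 < h by rewrite lt_min divr_gt0//= (lt_le_trans ltr01).
exists (s - h); apply: eP => /=.
- rewrite opprB addrC subrK gtr0_norm// (@le_lt_trans _ _ (e / 2))//.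
    by rewrite ge_min lexx.
  lra.
- by rewrite lt_eqF// ltrBlDr ltrDl.
- have : h <= s by rewrite ge_min lexx orbT.
  by rewrite /unitI/= in_itv/= => ?; lra.
Qed.

Lemma has_derivI_val f s l : unitI s -> has_derivI f s l -> derivI f s = l.
Proof.
by move=> /dnbhsI_proper ? fl; apply/cvg_lim => //; exact: Rhausdorff.
Qed.

Lemma has_derivI_derivable f s l : has_derivI f s l -> derivableI f s.
Proof. by move=> fl; apply/cvg_ex; exists l. Qed.

Lemma derivableI_has f s : derivableI f s -> has_derivI f s (derivI f s).
Proof. by move=> /cvgP. Qed.

Lemma nbhsI_near s (P : R -> Prop) : (forall t, unitI t -> t != s -> P t) ->
  \forall t \near within unitI s^', P t.
Proof.
by move=> IP; rewrite near_withinE /dnbhs near_withinE; apply: nearW => t ts It; exact: IP.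
Qed.

Lemma has_derivI_eq f u s l : unitI s -> (forall t, unitI t -> f t = u t) ->
  has_derivI f s l -> has_derivI u s l.
Proof.
move=> Is fu; apply: cvg_trans; apply: near_eq_cvg.
by apply: nbhsI_near => t It _; rewrite /slope !fu.
Qed.

Lemma dnbhsI_sub s : within unitI s^' `=>` within unitI (nbhs s).
Proof.
by move=> P; rewrite /dnbhs /within /=; apply: filterS => t Pt _ It; exact: Pt.
Qed.

Lemma has_derivI_cont f s l : has_derivI f s l ->
  f t @[t --> within unitI s^'] --> f s.
Proof.
move=> fl.
suff : (t - s) * slope f s t + f s @[t --> within unitI s^'] --> f s.
  apply: cvg_trans; apply: near_eq_cvg; apply: nbhsI_near => t _ ts.
  by rewrite /slope mulVKf ?subr_eq0// subrK.
rewrite -[X in _ --> X]add0r; apply: cvgD; last exact: cvg_cst.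
rewrite -(mul0r l); apply: cvgM => //.
rewrite -(subrr s); apply: cvgB; last exact: cvg_cst.
by apply: cvg_trans (@cvg_within _ _ _ _); exact: dnbhsI_sub.
Qed.

Lemma has_derivI_cst a s : has_derivI (fun=> a) s 0.
Proof.
by rewrite /has_derivI /slope; under eq_fun do rewrite subrr mulr0; exact: cvg_cst.
Qed.

Lemma has_derivID f u s l m : has_derivI f s l -> has_derivI u s m ->
  has_derivI (fun t => f t + u t) s (l + m).
Proof.
move=> fl um; apply: cvg_trans (cvgD fl um); apply: near_eq_cvg.
by apply: nearW => t; rewrite /slope /= -mulrDr; congr (_ * _); rewrite !fctE; ring.
Qed.

Lemma has_derivIM f u s l m : has_derivI f s l -> has_derivI u s m ->
  has_derivI (fun t => f t * u t) s (l * u s + f s * m).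
Proof.
move=> fl um; have cu := has_derivI_cont um.
have H : slope f s t * u t + f s * slope u s t @[t --> within unitI s^']
    --> l * u s + f s * m.
  by apply: cvgD; apply: cvgM => //; exact: cvg_cst.
apply: cvg_trans H; apply: near_eq_cvg.
apply: nearW => t; rewrite /slope /=; ring.
Qed.

(** The difference quotient of the outer function, completed by its derivative
    at the base point, is continuous there. *)
Lemma has_derivI_comp (h : R -> R) f s l m : is_derive (f s) 1 h m ->
  has_derivI f s l -> has_derivI (fun t => h (f t)) s (m * l).
Proof.
move=> hm fl; have cf := has_derivI_cont fl.
pose q y := if y == f s then m else (y - f s)^-1 * (h y - h (f s)).
have cq : q y @[y --> f s] --> m.
  apply/cvgrPdist_le => e e0.
  have /is_derive_eps/(_ e e0)[d d0 dP] := hm.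
  exists d => //= y; rewrite /ball_/= distrC => yd; rewrite /q; case: ifPn => [_|yfs].
    by rewrite subrr normr0 ltW.
  exact: dP.
have : q (f t) * slope f s t @[t --> within unitI s^'] --> m * l.
  by apply: cvgM => //; exact: (cvg_comp _ _ cf cq).
apply: cvg_trans; apply: near_eq_cvg; apply: nearW => t.
rewrite /slope /q; case: eqP => [->|/eqP fts]; first by rewrite !subrr !mulr0.
by set c := (t - s)^-1; field; rewrite subr_eq0.
Qed.

Lemma is_derive_has_derivI f s l : is_derive s (1 : R) f l -> has_derivI f s l.
Proof.
move=> /is_derive_eps fl; apply/cvgrPdist_le => e /fl[d d0 dP].
rewrite near_withinE /dnbhs near_withinE; exists d => //= t; rewrite /ball_/= distrC => td ts _; exact: dP.
Qed.

Lemma has_derivI_is_derive f s l : 0 < s < 1 -> has_derivI f s l ->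
  is_derive s (1 : R) f l.
Proof.
move=> /andP[s0 s1] /cvgrPdist_le fl; apply/is_derive_eps => e /fl.
rewrite near_withinE /dnbhs near_withinE => -[d /= d0 dP].
exists (Num.min d (Num.min s (1 - s))).
  by rewrite !lt_min d0 s0 subr_gt0.
move=> t; rewrite !lt_min => /andP[td /andP[ts ts1]] tns.
apply: dP => //=; first by rewrite distrC.
by move: ts ts1; rewrite /unitI/= in_itv/= !ltr_norml; lra.
Qed.

(** * C1 functions on the unit interval *)

Definition C1I f v := (forall s, unitI s -> has_derivI f s (v s)) /\ contI v.

Lemma C1I_cont f v : C1I f v -> contI f.
Proof.
move=> [fv _]; apply/contIP => s Is; apply/cvgrPdist_le => e e0.
have /cvgrPdist_le/(_ _ e0) := has_derivI_cont (fv _ Is).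
rewrite /dnbhs !near_withinE; apply: filterS => t tP It.
by have [->|ts] := eqVneq t s; [rewrite subrr normr0 ltW|exact: tP].
Qed.

Lemma C1I_CkI f v : C1I f v -> CkI 1 f.
Proof.
move=> fv; split=> [[|//] s _ Is|[|[|//]] _].
- by apply: (has_derivI_derivable (l := v s)); exact: fv.1.
- exact: (C1I_cont fv).
- by apply: contI_eq fv.2 => s Is; exact/esym/(has_derivI_val Is)/fv.1.
Qed.

Lemma C1I_derivI f v s : C1I f v -> unitI s -> derivI f s = v s.
Proof. by move=> [fv _] Is; exact: has_derivI_val (fv _ Is). Qed.

Lemma CkI_C1I f : CkI 1 f -> C1I f (derivI f).
Proof.
move=> [df cf]; split; last exact: (cf 1%N).
by move=> s Is; apply: derivableI_has; exact: (df 0%N).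
Qed.

Lemma C1I_eq f v f' v' : (forall s, unitI s -> f s = f' s) ->
  (forall s, unitI s -> v s = v' s) -> C1I f v -> C1I f' v'.
Proof.
move=> ff vv [fv cv]; split; last exact: contI_eq cv.
by move=> s Is; rewrite -vv//; apply: (has_derivI_eq Is ff); exact: fv.
Qed.

Lemma C1I_cst a : C1I (fun=> a) (fun=> 0).
Proof. by split; [move=> s _; exact: has_derivI_cst|exact: contI_cst]. Qed.

Lemma C1ID f v u w : C1I f v -> C1I u w ->
  C1I (fun s => f s + u s) (fun s => v s + w s).
Proof.
move=> [fv cv] [uw cw]; split; last exact: contID.
by move=> s Is; apply: has_derivID; auto.
Qed.

Lemma C1IM f v u w : C1I f v -> C1I u w ->
  C1I (fun s => f s * u s) (fun s => v s * u s + f s * w s).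
Proof.
move=> fv uw; have [fv' cv] := fv; have [uw' cw] := uw; split.
  by move=> s Is; apply: has_derivIM; auto.
by apply: contID; apply: contIM => //; [exact: C1I_cont uw|exact: C1I_cont fv].
Qed.

Lemma C1I_comp (h h' : R -> R) f v : (forall x : R, is_derive x (1 : R) h (h' x)) ->
  continuous h' -> C1I f v -> C1I (fun s => h (f s)) (fun s => h' (f s) * v s).
Proof.
move=> dh ch fv; have [fv' cv] := fv; split.
  by move=> s Is; apply: has_derivI_comp; auto.
by apply: contIM => //; apply: contI_comp => //; exact: C1I_cont fv.
Qed.

Lemma unitI_itv s : unitI s = (0 <= s <= 1) :> Prop.
Proof. by rewrite /unitI/= in_itv. Qed.

(** The second fundamental theorem of calculus. *)
Lemma C1I_is_L2_deriv f v : C1I f v -> is_L2_deriv f v.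
Proof.
move=> fv; have cf := C1I_cont fv; have [fv' cv] := fv.
split; first exact: contI_L2.
move=> t; rewrite unitI_itv => /andP[]; rewrite le_eqVlt => /predU1P[<- _|t0 t1].
  by rewrite set_itv1 Rintegral_set1 addr0.
have sub : `[0, t] `<=` unitI by apply: subset_itvl; rewrite bnd_simp.
have di x : x \in `]0, t[ -> is_derive (x : R) (1 : R) f (v x).
  rewrite in_itv/= => /andP[x0 xt]; apply: has_derivI_is_derive.
    by rewrite x0 (lt_le_trans xt).
  by apply: fv'; rewrite unitI_itv ltW//= ltW// (lt_le_trans xt).
rewrite /Rintegral (@continuous_FTC2 _ v f)//.
- by rewrite -EFinB/= addrC subrK.
- exact: continuous_subspaceW cv.
- have /continuous_within_itvP : {within `[0, t], continuous f}.
    exact: continuous_subspaceW cf.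
  by move=> /(_ t0)[_ f0 ft]; split=> // x /di[].
- by move=> x /di xd; rewrite derive1E derive_val.
Qed.

(** Extending v to a continuous function on the line by its values at the
    endpoints reduces this to the two-sided fundamental theorem of calculus. *)
Lemma C1I_int v : contI v -> C1I (fun t => \int[mu]_(s in `[0, t]) v s) v.
Proof.
move=> cv; split=> // x Ix.
pose k s : R := Num.max 0 (Num.min s 1).
have kI s : unitI (k s).
  by rewrite unitI_itv /k le_max lexx/= ge_max ler01 ge_min lexx orbT.
have kid s : unitI s -> k s = s.
  rewrite unitI_itv /k => /andP[s0 s1].
  by rewrite (min_idPl s1) (max_idPr s0).
pose v' s := v (k s).
have ck : continuous k.
  move=> s; apply: (@continuous_max _ _ (cst 0) (fun s => Num.min s 1)).
    exact: cvg_cst.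
  by apply: (@continuous_min _ _ id (cst 1)); [exact: cvg_id|exact: cvg_cst].
have cv' : continuous v'.
  move=> s; move/contIP : cv => /(_ _ (kI s)) cv.
  apply: (cvg_comp _ _ _ cv).
  move=> P nP.
  have kP : \forall z \near s, unitI (k z) -> P (k z) by exact: ck s _ nP.
  have : \forall z \near s, P (k z) by apply: filterS kP => z; apply; exact: kI.
  by [].
have iv' : mu.-integrable `[-1, 2] (EFin \o v').
  apply: continuous_compact_integrable; first exact: segment_compact.
  exact: continuous_subspaceT.
pose F (y : R) : R := \int[mu]_(s in `[-1, y]) v' s.
have x01 : 0 <= x <= 1 by rewrite -unitI_itv.
have [dF F'] : derivable F x 1 /\ F^`()%classic x = v' x.
  apply: (@continuous_FTC1_closed _ v' (-1) x 2) => //; [lra|lra|exact: cv'].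
have : has_derivI (fun y => F y + - F 0) x (v' x + 0).
  apply: has_derivID; last exact: has_derivI_cst.
  by apply: is_derive_has_derivI; apply: DeriveDef; [exact: dF|rewrite -derive1E; exact: F'].
rewrite addr0 /v' kid//; apply: has_derivI_eq => // t It.
have t01 : 0 <= t <= 1 by rewrite -unitI_itv.
have it : mu.-integrable `[-1, t] (EFin \o v').
  apply: integrableS iv'; [exact: measurable_itv|exact: measurable_itv|].
  by apply: subset_itvl; rewrite bnd_simp; lra.
rewrite /F (Rintegral_itvB it) ?bnd_simp; [|lra|lra].
rewrite Rintegral_itv_obnd_cbnd; last first.
  apply: integrableS it; [exact: measurable_itv|exact: measurable_itv|].
  by apply: subset_itvr; rewrite bnd_simp; lra.
apply: eq_Rintegral => s; rewrite inE/= in_itv/= => s01.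
by rewrite /v' kid// unitI_itv; lra.
Qed.

(** The primitive of such a function is nondecreasing with equal values at the
    endpoints, hence constant. *)
Lemma Rint_ge0_eq0 f : contI f -> (forall s, unitI s -> 0 <= f s) ->
  \int[mu]_(s in unitI) f s = 0 -> forall s, unitI s -> f s = 0.
Proof.
move=> cf f0 If0 s Is; have fF := C1I_int cf; have L := C1I_is_L2_deriv fF.
set F := fun _ => _ in fF L.
have F0 t : unitI t -> F t = 0.
  move=> It; have := It; rewrite unitI_itv => /andP[t0 t1].
  apply/eqP; rewrite eq_le; apply/andP; split.
    rewrite -If0 -subr_ge0 (is_L2_deriv_incr L It unitI1 t1).
    apply: Rintegral_ge0 => z; rewrite /= in_itv/= => zt; apply: f0.
    by rewrite unitI_itv; lra.
  apply: Rintegral_ge0 => z; rewrite /= in_itv/= => zt; apply: f0.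
  by rewrite unitI_itv; lra.
rewrite -(C1I_derivI fF Is); apply: has_derivI_val => //.
apply: (has_derivI_eq Is _ (has_derivI_cst 0 s)) => t It.
by rewrite F0.
Qed.

End derivatives_on_unitI.

(** * Sobolev functions *)

Section sobolev.
Context {R : realType}.
Implicit Types (f u v w : R -> R) (s t : R).

Lemma ae_neq (a : R) : {ae mu, forall s : R, s != a}.
Proof.
exists [set a]; split; [exact: measurable_set1|exact: lebesgue_measure_set1|].
by move=> s /= /negP; rewrite negbK => /eqP.
Qed.

(** At a Lebesgue point, the difference of the two derivatives is the derivative
    of a constant function. *)
Lemma is_L2_deriv_uniq f v v' : is_L2_deriv f v -> is_L2_deriv f v' ->
  {ae mu, forall s, unitI s -> v s = v' s}.
Proof.
move=> fv fv'.
have := is_L2_derivD fv (is_L2_derivZ (-1) fv').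
set d := (fun s => v s + _) => dP.
pose d' := d \_ unitI.
have id : mu.-integrable unitI (EFin \o d) := L2I_L1 (is_L2_deriv_L2 dP).
have id' : mu.-integrable unitI (EFin \o d').
  apply: (L1I_eq _ id) => s Is.
  by rewrite /d' patchE mem_set.
have loc := integrable_locally_restrict measurable_unitI id.
have := lebesgue_differentiation loc.
have nz := ae_neq 0; have n1 := ae_neq 1.
apply: filterS3 nz n1; first exact: (ae_filter_ringOfSetsType mu).
move=> s s0 s1 ls Is.
have s01 : 0 < s < 1.
  by move: Is; rewrite unitI_itv => /andP[? ?]; rewrite !lt_neqAle eq_sym s0 s1/=; apply/andP.
have [dF F'] := @FTC1_lebesgue_pt R d' (BLeft 0) s 1 (andP s01).2 id'
  (proj1 (andP s01)) ls.
move: dF F'; set F := fun _ => _ => dF F'.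
have : has_derivI F s (d' s).
  by apply: is_derive_has_derivI; apply: DeriveDef; [exact: dF|rewrite -derive1E; exact: F'].
move=> /(has_derivI_val Is).
have -> : derivI F s = 0.
  apply: has_derivI_val => //; apply: (has_derivI_eq Is _ (has_derivI_cst 0 s)).
  move=> t It; have := dP.2 t It.
  rewrite mulN1r subrr mulN1r subrr add0r => ->; apply: eq_Rintegral => z.
  rewrite inE/= in_itv/= => zt; rewrite /d' patchE mem_set//.
  by move: It; rewrite !unitI_itv; lra.
by rewrite /d' patchE mem_set// /d mulN1r => /esym/eqP; rewrite subr_eq0 => /eqP.
Qed.

(** Carrying both derivatives explicitly keeps the choice of a representative
    made in L2_deriv out of the calculus of H2 functions. *)
Definition has_H2 f v w := C1I f v /\ is_L2_deriv v w.

Lemma has_H2_H2 f v w : has_H2 f v w -> H2 f.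
Proof.
move=> [fv vw]; split; first exact: C1I_CkI fv.
exists w; apply: is_L2_deriv_eq vw => // s Is.
by rewrite (C1I_derivI fv Is).
Qed.

Lemma H2_has f : H2 f -> exists w, has_H2 f (derivI f) w.
Proof. by move=> [cf [w fw]]; exists w; split=> //; exact: CkI_C1I. Qed.

Lemma H2_has_L2_deriv f : H2 f -> has_H2 f (derivI f) (L2_deriv (derivI f)).
Proof.
move=> [cf fw]; split; first exact: CkI_C1I.
exact: (xgetPex (cst 0) fw).
Qed.

Lemma has_H2_is_L2_deriv f v w : has_H2 f v w -> is_L2_deriv f v.
Proof. by move=> [/C1I_is_L2_deriv]. Qed.

Lemma has_H2_eq f v w f' v' w' : (forall s, unitI s -> f s = f' s) ->
  (forall s, unitI s -> v s = v' s) -> (forall s, unitI s -> w s = w' s) ->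
  has_H2 f v w -> has_H2 f' v' w'.
Proof.
move=> ff vv ww [fv vw]; split; first exact: C1I_eq fv.
exact: is_L2_deriv_eq vw.
Qed.

Lemma has_H2_cst a : has_H2 (fun=> a) (fun=> 0) (fun=> 0).
Proof. by split; [exact: C1I_cst|exact: is_L2_deriv_cst]. Qed.

Lemma has_H2D f v w f' v' w' : has_H2 f v w -> has_H2 f' v' w' ->
  has_H2 (fun s => f s + f' s) (fun s => v s + v' s) (fun s => w s + w' s).
Proof.
by move=> [fv vw] [fv' vw']; split; [exact: C1ID|exact: is_L2_derivD].
Qed.

Lemma has_H2_sum (J : Type) (r : seq J) (F V W : J -> R -> R) :
  (forall j, has_H2 (F j) (V j) (W j)) ->
  has_H2 (fun s => \sum_(j <- r) F j s) (fun s => \sum_(j <- r) V j s)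
    (fun s => \sum_(j <- r) W j s).
Proof.
move=> FVW; elim: r => [|j r IH].
  by apply: has_H2_eq (has_H2_cst 0) => s _; rewrite big_nil.
by apply: has_H2_eq (has_H2D (FVW j) IH) => s _; rewrite big_cons.
Qed.

Lemma has_H2M f v w f' v' w' : has_H2 f v w -> has_H2 f' v' w' ->
  has_H2 (fun s => f s * f' s) (fun s => v s * f' s + f s * v' s)
    (fun s => (w s * f' s + v s * v' s) + (v s * v' s + f s * w' s)).
Proof.
move=> H H'; have [fv vw] := H; have [fv' vw'] := H'; split; first exact: C1IM.
apply: is_L2_derivD; apply: is_L2_derivM => //.
  exact: has_H2_is_L2_deriv H'.
exact: has_H2_is_L2_deriv H.
Qed.

Lemma has_H2Z a f v w : has_H2 f v w ->
  has_H2 (fun s => a * f s) (fun s => a * v s) (fun s => a * w s).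
Proof.
move=> /(has_H2M (has_H2_cst a)); apply: has_H2_eq => s _.
- by [].
- by rewrite mul0r add0r.
- by rewrite !mul0r !add0r.
Qed.

Lemma has_H2_comp (h h' h'' : R -> R) f v w :
  (forall x : R, is_derive x (1 : R) h (h' x)) ->
  (forall x : R, is_derive x (1 : R) h' (h'' x)) -> continuous h'' ->
  has_H2 f v w ->
  has_H2 (fun s => h (f s)) (fun s => h' (f s) * v s)
    (fun s => h'' (f s) * v s * v s + h' (f s) * w s).
Proof.
move=> dh dh' ch'' [fv vw].
have ch' : continuous h'.
  by move=> x; exact: is_derive_continuous (dh' x).
split; first exact: C1I_comp.
apply: is_L2_derivM => //; apply: C1I_is_L2_deriv; exact: C1I_comp.
Qed.

Lemma has_H2_sqnorm f v w : has_H2 f v w ->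
  L1I (fun s => f s ^+ 2 + v s ^+ 2 + w s ^+ 2) /\
  H2_sqnorm f = \int[mu]_(s in unitI) (f s ^+ 2 + v s ^+ 2 + w s ^+ 2).
Proof.
move=> [fv vw]; have cf := C1I_cont fv; have [_ cv] := fv.
have lw := is_L2_deriv_L2 vw.
have l1 : L1I (fun s => f s ^+ 2 + v s ^+ 2 + w s ^+ 2).
  apply: L1ID; last exact: L2I_sqr.
  by apply/contI_L1/contID; exact: contIX.
split=> //.
have dw : is_L2_deriv (derivI f) w.
  by apply: is_L2_deriv_eq vw => // s /(C1I_derivI fv) ->.
have dd : is_L2_deriv (derivI f) (L2_deriv (derivI f)).
  by rewrite /L2_deriv; apply: (xgetPex (cst 0)); exists w.
rewrite /H2_sqnorm /Rintegral; congr fine; apply: ae_eq_integral.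
- exact: measurable_unitI.
- apply/measurable_EFinP/measurable_funD; last first.
    by apply: measurable_funX; case: dd => -[].
  apply: contI_meas; apply: contID; apply: contIX => //.
  by apply: contI_eq cv => s /(C1I_derivI fv) ->.
- by apply/measurable_EFinP; exact: L1I_meas.
- have := is_L2_deriv_uniq dd dw; apply: filterS; first exact: (ae_filter_ringOfSetsType mu).
  by move=> s ws Is; rewrite ws// (C1I_derivI fv).
Qed.

Lemma H2_sqnorm_ge f v w : has_H2 f v w ->
  \int[mu]_(s in unitI) (f s ^+ 2 + v s ^+ 2) <= H2_sqnorm f.
Proof.
move=> H; have [l1 ->] := has_H2_sqnorm H; have [fv vw] := H.
apply: Rint_le => //; last by move=> s _; rewrite lerDl sqr_ge0.
by apply/contI_L1/contID; apply: contIX; [exact: C1I_cont fv|exact: fv.2].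
Qed.

Lemma H2_sqnorm_ge0 f : 0 <= H2_sqnorm f.
Proof. by apply: Rintegral_ge0 => s _; rewrite !addr_ge0// sqr_ge0. Qed.

(** The variation of f^2 is at most the integral of |2 f f'|, hence of f^2 + f'^2;
    averaging over the base point bounds f^2 itself. *)
Lemma H2_sqnorm_sup f v w s : has_H2 f v w -> unitI s ->
  f s ^+ 2 <= 2 * H2_sqnorm f.
Proof.
move=> H Is; have [fv vw] := H; have cf := C1I_cont fv; have [_ cv] := fv.
have ff := has_H2_is_L2_deriv H.
have l1 : L1I (fun t => f t ^+ 2 + v t ^+ 2).
  by apply/contI_L1/contID; apply: contIX.
have dff := is_L2_derivM ff ff.
pose J := \int[mu]_(t in unitI) (f t ^+ 2 + v t ^+ 2).
have osc a b : unitI a -> unitI b -> a <= b -> `|f b * f b - f a * f a| <= J.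
  move=> Ia Ib ab; rewrite (is_L2_deriv_incr dff)//.
  have sub : `]a, b]%classic `<=` unitI.
    move=> z; move: Ia Ib; rewrite !unitI_itv /= in_itv/=; lra.
  have l2 : L1I (fun t => v t * f t + f t * v t).
    by apply/contI_L1/contID; apply: contIM.
  apply: (le_trans (le_normr_Rintegral _ _)) => //; first exact: L1I_sub2.
  apply: (@le_trans _ _ (\int[mu]_(t in `]a, b]) (f t ^+ 2 + v t ^+ 2))).
    apply: le_Rintegral => //; [|exact: L1I_sub2|].
      exact: (integrable_norm (L1I_sub2 Ia Ib l2)).
    move=> t _; rewrite ler_norml.
    by have := sqr_ge0 (f t - v t); have := sqr_ge0 (f t + v t); nra.
  rewrite /J /Rintegral fine_le//.
  - by apply: integrable_fin_num => //; exact: L1I_sub2.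
  - by apply: integrable_fin_num => //; exact: measurable_unitI.
  - apply: ge0_subset_integral => //; [exact: measurable_unitI| |].
      by apply/measurable_EFinP; exact: L1I_meas.
    by move=> t _; rewrite lee_fin addr_ge0// sqr_ge0.
have fst t : unitI t -> f s ^+ 2 <= f t ^+ 2 + J.
  move=> It; have : `|f s * f s - f t * f t| <= J.
    by have [st|/ltW ts] := leP s t; [rewrite distrC|]; exact: osc.
  by move=> /ler_normlW; rewrite !expr2; lra.
have : f s ^+ 2 <= \int[mu]_(t in unitI) (f t ^+ 2 + J).
  rewrite -[leLHS]Rint_cst; apply: Rint_le => //; first exact/contI_L1/contI_cst.
  by apply: L1ID; [exact/contI_L1/contIX|exact/contI_L1/contI_cst].
rewrite RintD; [|exact/contI_L1/contIX|exact/contI_L1/contI_cst].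
rewrite Rint_cst => /le_trans; apply.
have fJ : \int[mu]_(t in unitI) f t ^+ 2 <= J.
  apply: Rint_le => //; first exact/contI_L1/contIX.
  by move=> t _; rewrite lerDl sqr_ge0.
by have := H2_sqnorm_ge H; rewrite -/J; lra.
Qed.

End sobolev.

(** * Matrix-valued curves *)

Section matrix_curves.
Context {R : realType}.

Definition contI_mx m n (F : R -> 'M[R]_(m, n)) :=
  forall i j, contI (fun s => F s i j).

Lemma contI_mulmx m n p (F : R -> 'M[R]_(m, n)) (H : R -> 'M[R]_(n, p)) :
  contI_mx F -> contI_mx H -> contI_mx (fun s => F s *m H s).
Proof.
move=> cF cH i j; apply: (@contI_eq _ (fun s => \sum_l F s i l * H s l j)).
  by move=> s _; rewrite mxE.
by apply: contI_sum => l; exact: contIM.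
Qed.

Lemma contI_submx m n (F H : R -> 'M[R]_(m, n)) :
  contI_mx F -> contI_mx H -> contI_mx (fun s => F s - H s).
Proof.
move=> cF cH i j; apply: (@contI_eq _ (fun s => F s i j - H s i j)).
  by move=> s _; rewrite !mxE.
exact: contIB.
Qed.

Lemma contI_trmx m n (F : R -> 'M[R]_(m, n)) :
  contI_mx F -> contI_mx (fun s => (F s)^T).
Proof.
by move=> cF i j; apply: (contI_eq _ (cF j i)) => s _; rewrite mxE.
Qed.

Lemma contI_cstmx m n (A : 'M[R]_(m, n)) : contI_mx (fun _ : R => A).
Proof. by move=> i j; exact: contI_cst. Qed.

Lemma contI_jet n k (c : R -> 'cV[R]_n) : CkI_mx k c ->
  contI_mx (fun s => jet c s : 'M[R]_(n, k)).
Proof.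
move=> cc i j.
apply: (@contI_eq _ (iter j.+1 derivI (fun t => c t i 0))).
  by move=> s _; rewrite mxE.
exact: (cc i 0).2.
Qed.

Lemma ip_LE n k (lam : 'rV[R]_k) (A B : 'M[R]_(n, k)) :
  ip_L lam A B = \sum_a \sum_i lam 0 i * (A a i * B a i).
Proof.
rewrite /ip_L /mxtrace exchange_big; apply: eq_bigr => i _ /=.
rewrite -mulmxA mul_diag_mx !mxE mulr_sumr.
by apply: eq_bigr => a _; rewrite !mxE.
Qed.

Lemma contI_ip_L n k (lam : 'rV[R]_k) (F H : R -> 'M[R]_(n, k)) :
  contI_mx F -> contI_mx H -> contI (fun s => ip_L lam (F s) (H s)).
Proof.
move=> cF cH; under eq_fun do rewrite ip_LE.
apply: contI_sum => a; apply: contI_sum => i.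
by apply: contIM; [exact: contI_cst|exact: contIM].
Qed.

Lemma contI_ip_o n (F H : R -> 'M[R]_n) :
  contI_mx F -> contI_mx H -> contI (fun s => ip_o (F s) (H s)).
Proof.
move=> cF cH; under eq_fun do rewrite ip_oE.
by apply: contI_sum => a; apply: contI_sum => i; exact: contIM.
Qed.

Lemma ip_L_sqrD n k (lam : 'rV[R]_k) (X Y : 'M[R]_(n, k)) h :
  ip_L lam (X + h *: Y) (X + h *: Y) =
  ip_L lam X X + 2 * h * ip_L lam X Y + h ^+ 2 * ip_L lam Y Y.
Proof.
rewrite !ip_LE !mulr_sumr -!big_split; apply: eq_bigr => a _ /=.
rewrite !mulr_sumr -!big_split; apply: eq_bigr => i _ /=.
by rewrite !mxE; ring.
Qed.

Lemma ip_o_sqrD n (X Y : 'M[R]_n) h :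
  ip_o (X + h *: Y) (X + h *: Y) =
  ip_o X X + 2 * h * ip_o X Y + h ^+ 2 * ip_o Y Y.
Proof.
rewrite !ip_oE !mulr_sumr -!big_split; apply: eq_bigr => a _ /=.
rewrite !mulr_sumr -!big_split; apply: eq_bigr => i _ /=.
by rewrite !mxE; ring.
Qed.

Lemma ip_LD n k (lam : 'rV[R]_k) (X Y Z : 'M[R]_(n, k)) :
  ip_L lam X (Y + Z) = ip_L lam X Y + ip_L lam X Z.
Proof. by rewrite /ip_L mulmxDr mxtraceD. Qed.

Lemma ip_oD n (X Y Z : 'M[R]_n) : ip_o X (Y + Z) = ip_o X Y + ip_o X Z.
Proof. by rewrite /ip_o mulmxDr mxtraceD. Qed.

Lemma ip_L_ge0 n k (lam : 'rV[R]_k) (X : 'M[R]_(n, k)) :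
  (forall i, 0 < lam 0 i) -> 0 <= ip_L lam X X.
Proof.
move=> lam0; rewrite ip_LE; apply: sumr_ge0 => a _; apply: sumr_ge0 => i _.
by apply: mulr_ge0; [exact/ltW/lam0|rewrite -expr2 sqr_ge0].
Qed.

Lemma ip_o_ge0 n (X : 'M[R]_n) : 0 <= ip_o X X.
Proof.
rewrite ip_oE; apply: sumr_ge0 => a _; apply: sumr_ge0 => i _.
by rewrite -expr2 sqr_ge0.
Qed.

(** Expand the squared norms of X + e^-1 Y and of X - e^-1 Y. *)
Lemma ip_o_young n (X Y : 'M[R]_n) e : 0 < e ->
  `|ip_o X Y| <= 2^-1 * (e * ip_o X X + e^-1 * ip_o Y Y).
Proof.
move=> e0.
have P := ip_o_ge0 (X + e^-1 *: Y); have N := ip_o_ge0 (X + (- e^-1) *: Y).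
move: P N; rewrite !ip_o_sqrD sqrrN.
rewrite -(pmulr_rge0 _ e0) => P; rewrite -(pmulr_rge0 _ e0) => N.
have E1 : e * (ip_o X X + 2 * e^-1 * ip_o X Y + e^-1 ^+ 2 * ip_o Y Y) =
    e * ip_o X X + 2 * ip_o X Y + e^-1 * ip_o Y Y.
  by field; rewrite gt_eqF.
have E2 : e * (ip_o X X + 2 * - e^-1 * ip_o X Y + e^-1 ^+ 2 * ip_o Y Y) =
    e * ip_o X X - 2 * ip_o X Y + e^-1 * ip_o Y Y.
  by field; rewrite gt_eqF.
by rewrite ler_norml; move: P N; rewrite E1 E2; lra.
Qed.

Lemma H2_mx_lin m n (A B : R -> 'M[R]_(m, n)) a : H2_mx A -> H2_mx B ->
  H2_mx (fun s => A s + a *: B s) /\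
  forall s, unitI s ->
    derivI_mx (fun s => A s + a *: B s) s = derivI_mx A s + a *: derivI_mx B s.
Proof.
move=> hA hB.
have H i j : exists w, has_H2 (fun t => (A t + a *: B t) i j)
    (fun s => derivI_mx A s i j + a * derivI_mx B s i j) w.
  have [w1 H1] := H2_has (hA i j); have [w2 H2] := H2_has (hB i j).
  exists (fun s => w1 s + a * w2 s).
  apply: has_H2_eq (has_H2D H1 (has_H2Z a H2)) => // s _.
  - by rewrite !mxE.
  - by rewrite !mxE.
split=> [i j|s Is]; first by have [w /has_H2_H2] := H i j.
apply/matrixP => i j; have [w [Hij _]] := H i j.
by rewrite [LHS]mxE (C1I_derivI Hij Is) !mxE.
Qed.

Lemma H2_mx_cst m n (A : 'M[R]_(m, n)) : H2_mx (fun _ : R => A).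
Proof. by move=> i j; exact: has_H2_H2 (has_H2_cst (A i j)). Qed.

Lemma H2_mx_cont m n (A : R -> 'M[R]_(m, n)) : H2_mx A -> contI_mx A.
Proof. by move=> hA i j; have [w [/C1I_cont]] := H2_has (hA i j). Qed.

Lemma H2_mx_derivI_cont m n (A : R -> 'M[R]_(m, n)) :
  H2_mx A -> contI_mx (derivI_mx A).
Proof.
move=> hA i j; have [w [[_ cv] _]] := H2_has (hA i j).
by apply: (contI_eq _ cv) => s _; rewrite mxE.
Qed.

Lemma H2_norm_sqr m n (A : R -> 'M[R]_(m, n)) :
  H2_norm A ^+ 2 = \sum_i \sum_j H2_sqnorm (fun t => A t i j).
Proof.
rewrite /H2_norm sqr_sqrtr//; apply: sumr_ge0 => i _; apply: sumr_ge0 => j _.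
exact: H2_sqnorm_ge0.
Qed.

Lemma H2_sqnorm_le_norm m n (A : R -> 'M[R]_(m, n)) i j :
  H2_sqnorm (fun t => A t i j) <= H2_norm A ^+ 2.
Proof.
have term (I : finType) (F : I -> R) a : (forall b, 0 <= F b) ->
    F a <= \sum_b F b.
  by move=> F0; rewrite (bigD1 a)//= lerDl sumr_ge0.
have N0 a b := H2_sqnorm_ge0 (fun t => A t a b).
rewrite H2_norm_sqr.
apply: (le_trans (term _ (fun b => H2_sqnorm (fun t => A t i b)) j (N0 i))).
apply: (term _ (fun a => \sum_b H2_sqnorm (fun t => A t a b)) i) => a.
by apply: sumr_ge0.
Qed.

Lemma H2_norm_ge0 m n (A : R -> 'M[R]_(m, n)) : 0 <= H2_norm A.
Proof. exact: sqrtr_ge0. Qed.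

Lemma H2_norm_sup m n (A : R -> 'M[R]_(m, n)) i j s : H2_mx A -> unitI s ->
  `|A s i j| <= 2 * H2_norm A.
Proof.
move=> hA Is; have [w H] := H2_has (hA i j).
have := H2_sqnorm_sup H Is; have := H2_sqnorm_le_norm A i j.
move=> h1 h2; rewrite -(@ler_pXn2r _ 2)// ?nnegrE ?mulr_ge0 ?H2_norm_ge0//.
rewrite real_normK ?num_real// exprMn; have := sqr_ge0 (H2_norm A); nra.
Qed.

Lemma H2_mx_quotient m n (A B U : R -> 'M[R]_(m, n)) a :
  H2_mx A -> H2_mx B -> H2_mx U -> H2_mx (fun s => a *: (A s - B s) - U s).
Proof.
move=> hA hB hU; have h1 := (H2_mx_lin (-1) hA hB).1.
have h2 := (H2_mx_lin a (H2_mx_cst 0) h1).1.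
have := (H2_mx_lin (-1) h2 hU).1; congr H2_mx.
by apply/funext => s; rewrite add0r !scaleN1r.
Qed.

(** The condition on the successive derivatives D of a smooth family that its
    definition leaves under an existential quantifier. *)
Definition smooth_H2_jet m n (delta : R) (D : nat -> R -> R -> 'M[R]_(m, n)) :=
  forall j e, `|e| < delta -> H2_mx (D j e) /\
    H2_norm (fun s => h^-1 *: (D j (e + h) s - D j e s) - D j.+1 e s)
      @[h --> (0 : R)^'] --> (0 : R).

End matrix_curves.

(** * The first variation of the energy *)

Section first_variation.
Context {R : realType} {n k : nat}.
Variables (c1 c2 : R -> 'cV[R]_n) (lam : 'rV[R]_k).
Hypotheses (c1_Ck : CkI_mx k c1) (c2_Ck : CkI_mx k c2).
Hypothesis lam_gt0 : forall i, 0 < lam 0 i.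
Implicit Types (g V : R -> 'M[R]_n).

Notation j1 s := (jet c1 s : 'M[R]_(n, k)).
Notation j2 s := (jet c2 s : 'M[R]_(n, k)).

Lemma orthogonal_invmx (A : 'M[R]_n) : orthogonal_mx A -> invmx A = A^T.
Proof.
rewrite /orthogonal_mx => AA; have [_ uA] := mulmx1_unit AA.
by rewrite -[invmx A]mul1mx -AA mulmxK.
Qed.

Lemma orthogonal_mul_tr (A : 'M[R]_n) : orthogonal_mx A -> A *m A^T = 1%:M.
Proof. exact: mulmx1C. Qed.

Lemma ip_o_orthogonal (Q A B : 'M[R]_n) :
  orthogonal_mx Q -> ip_o (Q *m A) (Q *m B) = ip_o A B.
Proof.
by move=> QQ; rewrite /ip_o trmx_mul -mulmxA [Q^T *m _]mulmxA QQ mul1mx.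
Qed.

Definition density g s : R :=
  ip_L lam (g s *m j1 s - j2 s) (g s *m j1 s - j2 s) +
  ip_o (derivI_mx g s) (derivI_mx g s).

(** The coefficients of the expansion of density (g + h V) in powers of h: half
    of the linear one, and the quadratic one. *)
Definition density1 g V s : R :=
  ip_L lam (g s *m j1 s - j2 s) (V s *m j1 s) +
  ip_o (derivI_mx g s) (derivI_mx V s).

Definition density2 V s : R :=
  ip_L lam (V s *m j1 s) (V s *m j1 s) + ip_o (derivI_mx V s) (derivI_mx V s).

Definition energy1 g V : R := \int[mu]_(s in unitI) density1 g V s.

(** On O(n) the norm of the logarithmic derivative is that of the derivative, so
    that the energy is a quadratic polynomial in g. *)
Lemma energy_quadratic g : H2_O g ->
  energy lam c1 c2 g = 2^-1 * \int[mu]_(s in unitI) density g s.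
Proof.
move=> [_ Og]; rewrite /energy; congr (_ * _); apply: Rint_eq => s Is.
rewrite /norm_L /norm_o !sqr_sqrtr ?ip_o_ge0 ?ip_L_ge0//.
rewrite /density /log_deriv orthogonal_invmx; last exact: Og.
congr (_ + _); rewrite -[LHS](ip_o_orthogonal _ _ (Og s Is)) mulmxA.
by rewrite orthogonal_mul_tr ?mul1mx; last exact: Og.
Qed.

Lemma contI_resid g : contI_mx g -> contI_mx (fun s => g s *m j1 s - j2 s).
Proof.
move=> cg; apply: contI_submx; last exact: contI_jet.
by apply: contI_mulmx => //; exact: contI_jet.
Qed.

Lemma density_cont g : H2_mx g -> contI (density g).
Proof.
move=> hg; have cg := H2_mx_cont hg; have cg' := H2_mx_derivI_cont hg.
by apply: contID; [apply: contI_ip_L; exact: contI_resid|exact: contI_ip_o].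
Qed.

Lemma density1_cont g V : H2_mx g -> H2_mx V -> contI (density1 g V).
Proof.
move=> hg hV; have cg := H2_mx_cont hg; have cg' := H2_mx_derivI_cont hg.
have cV := H2_mx_cont hV; have cV' := H2_mx_derivI_cont hV.
apply: contID; last exact: contI_ip_o.
apply: contI_ip_L; first exact: contI_resid.
by apply: contI_mulmx => //; exact: contI_jet.
Qed.

Lemma density2_cont V : H2_mx V -> contI (density2 V).
Proof.
move=> hV; have cV := H2_mx_cont hV; have cV' := H2_mx_derivI_cont hV.
apply: contID; last exact: contI_ip_o.
by apply: contI_ip_L; apply: contI_mulmx => //; exact: contI_jet.
Qed.

Lemma densityD g V h s : H2_mx g -> H2_mx V -> unitI s ->
  density (fun s => g s + h *: V s) s =
  density g s + 2 * h * density1 g V s + h ^+ 2 * density2 V s.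
Proof.
move=> hg hV Is; rewrite /density (H2_mx_lin h hg hV).2// ip_o_sqrD.
rewrite mulmxDl -scalemxAl addrAC ip_L_sqrD /density1 /density2; ring.
Qed.

Lemma energyD g V h : H2_mx g -> H2_mx V ->
  \int[mu]_(s in unitI) density (fun s => g s + h *: V s) s =
  \int[mu]_(s in unitI) density g s + 2 * h * energy1 g V +
  h ^+ 2 * \int[mu]_(s in unitI) density2 V s.
Proof.
move=> hg hV.
have l0 := contI_L1 (density_cont hg).
have l1 := contI_L1 (density1_cont hg hV).
have l2 := contI_L1 (density2_cont hV).
have l1' := L1IZ (2 * h) l1; have l2' := L1IZ (h ^+ 2) l2.
rewrite (Rint_eq (fun s Is => densityD h hg hV Is)).
by rewrite RintD//; [rewrite RintD// RintZ// RintZ|exact: L1ID].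
Qed.

Lemma energy1D g U V : H2_mx g -> H2_mx U -> H2_mx V ->
  energy1 g (fun s => U s + V s) = energy1 g U + energy1 g V.
Proof.
move=> hg hU hV; rewrite /energy1 -RintD; last 2 first.
- exact/contI_L1/density1_cont.
- exact/contI_L1/density1_cont.
apply: Rint_eq => s Is; have := (H2_mx_lin 1 hU hV).2 s Is.
rewrite scale1r; under [X in derivI_mx X]eq_fun do rewrite scale1r.
by rewrite /density1 mulmxDl ip_LD => ->; rewrite ip_oD addrACA.
Qed.

Lemma density2D U V s : H2_mx U -> H2_mx V -> unitI s ->
  density2 (fun s => U s + V s) s <= 2 * density2 U s + 2 * density2 V s.
Proof.
move=> hU hV Is; have := (H2_mx_lin 1 hU hV).2 s Is.
rewrite scale1r; under [X in derivI_mx X]eq_fun do rewrite scale1r.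
rewrite /density2 mulmxDl => ->.
set X := U s *m _; set Y := V s *m _; set X' := derivI_mx U s; set Y' := derivI_mx V s.
have := ip_L_sqrD lam X Y 1; have := ip_o_sqrD X' Y' 1.
have := ip_L_sqrD lam X Y (-1); have := ip_o_sqrD X' Y' (-1).
rewrite !scale1r => e1 e2 -> ->.
have := ip_L_ge0 (X + -1 *: Y) lam_gt0; have := ip_o_ge0 (X' + -1 *: Y').
by rewrite e1 e2; lra.
Qed.

(** A perturbation that is small in H2 is uniformly small, so the terms in
    g j1 - j2 are small pointwise; those in the derivatives are small in mean by
    Young's inequality. *)
Lemma energy_small g : H2_mx g -> exists2 C, 0 <= C &
  forall V e, H2_mx V -> 0 < e -> e <= 1 -> H2_norm V <= e ->
    `|energy1 g V| <= C * e /\ \int[mu]_(s in unitI) density2 V s <= C.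
Proof.
move=> hg; have cg := H2_mx_cont hg; have cg' := H2_mx_derivI_cont hg.
pose b i s : R := 2 * \sum_l `|j1 s l i|.
have cj := contI_jet c1_Ck.
have cb i : contI (b i).
  apply: contIM; first exact: contI_cst.
  by apply: contI_sum => l; exact: contI_abs.
pose p s := \sum_a \sum_i lam 0 i * (`|(g s *m j1 s - j2 s) a i| * b i s).
pose q s := \sum_(a < n) \sum_i lam 0 i * (b i s * b i s).
have cp : contI p.
  apply: contI_sum => a; apply: contI_sum => i; apply: contIM; first exact: contI_cst.
  by apply: contIM => //; apply: contI_abs; exact: contI_resid.
have cq : contI q.
  apply: contI_sum => a; apply: contI_sum => i; apply: contIM; first exact: contI_cst.
  by apply: contIM.
have b0 i s : 0 <= b i s by rewrite mulr_ge0// sumr_ge0.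
have p0 s : 0 <= p s.
  apply: sumr_ge0 => a _; apply: sumr_ge0 => i _.
  by apply: mulr_ge0; [exact/ltW/lam_gt0|apply: mulr_ge0].
have q0 s : 0 <= q s.
  apply: sumr_ge0 => a _; apply: sumr_ge0 => i _.
  by apply: mulr_ge0; [exact/ltW/lam_gt0|apply: mulr_ge0].
have cgg : contI (fun s => ip_o (derivI_mx g s) (derivI_mx g s)) by exact: contI_ip_o.
pose P := \int[mu]_(s in unitI) p s; pose Q := \int[mu]_(s in unitI) q s.
pose G := \int[mu]_(s in unitI) ip_o (derivI_mx g s) (derivI_mx g s).
have P0 : 0 <= P by apply: Rintegral_ge0.
have Q0 : 0 <= Q by apply: Rintegral_ge0.
have G0 : 0 <= G by apply: Rintegral_ge0 => s _; exact: ip_o_ge0.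
exists (P + Q + G + 1); first by rewrite !addr_ge0.
move=> V e hV e0 e1 Ve.
have cV := H2_mx_cont hV; have cV' := H2_mx_derivI_cont hV.
have cVV : contI (fun s => ip_o (derivI_mx V s) (derivI_mx V s)) by exact: contI_ip_o.
have Vs s a l : unitI s -> `|V s a l| <= 2 * e.
  by move=> Is; apply: (le_trans (H2_norm_sup _ _ hV Is)); rewrite ler_pM2l.
have Vj s a i : unitI s -> `|(V s *m j1 s) a i| <= e * b i s.
  move=> Is; rewrite mxE (le_trans (ler_norm_sum _ _ _))//.
  rewrite /b mulrCA !mulr_sumr; apply: ler_sum => l _.
  by rewrite normrM mulrA ler_wpM2r// Vs.
have V2 : \int[mu]_(s in unitI) ip_o (derivI_mx V s) (derivI_mx V s) <= e ^+ 2.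
  have le1 : H2_norm V ^+ 2 <= e ^+ 2 by rewrite lerXn2r ?nnegrE ?H2_norm_ge0// ltW.
  apply: le_trans le1; rewrite H2_norm_sqr.
  under eq_Rintegral do rewrite ip_oE.
  have lV i j : L1I (fun s => derivI_mx V s i j * derivI_mx V s i j).
    by apply: contI_L1; exact: contIM.
  have lVi i := Rint_sum (index_enum 'I_n) (fun j => lV i j).
  rewrite (Rint_sum (index_enum 'I_n) (fun i => (lVi i).1)).2.
  apply: ler_sum => i _; rewrite (lVi i).2; apply: ler_sum => j _.
  have [w H] := H2_has (hV i j); apply: le_trans (H2_sqnorm_ge H).
  have [Hc Hl] := H.
  apply: Rint_le => [//||s _]; last by rewrite mxE -expr2 lerDr sqr_ge0.
  by apply/contI_L1/contID; apply: contIX; [exact: C1I_cont Hc|exact: Hc.2].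
split.
  have l1 := contI_L1 (density1_cont hg hV).
  apply: (le_trans (le_normr_Rintegral _ l1)); first exact: measurable_unitI.
  apply: (@le_trans _ _ (\int[mu]_(s in unitI) (e * p s +
     2^-1 * (e * ip_o (derivI_mx g s) (derivI_mx g s) +
             e^-1 * ip_o (derivI_mx V s) (derivI_mx V s))))).
    apply: Rint_le; first exact: L1I_abs.
      apply: contI_L1; apply: contID; first by apply: contIM => //; exact: contI_cst.
      apply: contIM; first exact: contI_cst.
      by apply: contID; apply: contIM => //; exact: contI_cst.
    move=> s Is; apply: (le_trans (ler_normD _ _)); apply: lerD; last exact: ip_o_young.
    rewrite ip_LE (le_trans (ler_norm_sum _ _ _))// mulr_sumr; apply: ler_sum => a _.
    rewrite (le_trans (ler_norm_sum _ _ _))// mulr_sumr; apply: ler_sum => i _.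
    rewrite !normrM gtr0_norm// [leRHS]mulrCA ler_pM2l// [leRHS]mulrCA ler_wpM2l//.
    exact: Vj.
  have lgg := contI_L1 cgg; have lVV := contI_L1 cVV; have lp := contI_L1 cp.
  have lgVe : L1I (fun s => e * ip_o (derivI_mx g s) (derivI_mx g s) +
             e^-1 * ip_o (derivI_mx V s) (derivI_mx V s)).
    by apply: L1ID; exact: L1IZ.
  rewrite RintD; [|exact: L1IZ|exact: L1IZ].
  rewrite RintZ// RintZ// RintD; [|exact: L1IZ|exact: L1IZ].
  rewrite RintZ// RintZ// -/P -/G.
  have Ve2 : e^-1 * \int[mu]_(s in unitI) ip_o (derivI_mx V s) (derivI_mx V s) <= e.
    by rewrite mulrC ler_pdivrMr// -expr2.
  have := mulr_ge0 (ltW e0) G0; have := mulr_ge0 (ltW e0) Q0; nra.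
have lq := contI_L1 cq; have lVV := contI_L1 cVV.
apply: (@le_trans _ _ (\int[mu]_(s in unitI) (q s +
    ip_o (derivI_mx V s) (derivI_mx V s)))).
  apply: Rint_le; [exact/contI_L1/density2_cont|exact: L1ID|move=> s Is].
  rewrite lerD2r ip_LE; apply: ler_sum => a _; apply: ler_sum => i _.
  rewrite ler_pM2l//; apply: (le_trans (ler_norm _)); rewrite normrM.
  have := Vj s a i Is; have := b0 i s; have := normr_ge0 ((V s *m j1 s) a i).
  set x := `|_|; set y := b i s => x0 y0 xy.
  have xy1 : x <= y by apply: (le_trans xy); rewrite ler_piMl.
  by rewrite ler_pM.
rewrite RintD// -/Q.
have : e ^+ 2 <= 1 by rewrite expr_le1// ltW.
lra.
Qed.

Lemma quotient_estimate (E F S M K C h e : R) : h != 0 ->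
  `|F| <= e / 2 -> 0 <= M -> M <= 2 * (K + C) -> 0 <= K -> 0 <= C ->
  `|h| <= e / (2 * (K + C + 1)) ->
  `|E - h^-1 * (2^-1 * (S + 2 * h * (E + F) + h ^+ 2 * M) - 2^-1 * S)| <= e.
Proof.
move=> h0 Fe M0 MK K0 C0 he.
have -> : E - h^-1 * (2^-1 * (S + 2 * h * (E + F) + h ^+ 2 * M) - 2^-1 * S) =
    - (F + h * M / 2) by field.
rewrite normrN (le_trans (ler_normD _ _))//.
have -> : e = e / 2 + e / 2 by field.
apply: lerD => //.
rewrite !normrM (ger0_norm M0) [`|2^-1|]ger0_norm ?invr_ge0// -mulrA.
have hMK : M / 2 <= K + C + 1 by lra.
apply: (le_trans (ler_pM _ _ he hMK)) => //; first by rewrite divr_ge0.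
have KC : K + C + 1 != 0 by rewrite gt_eqF// ltr_wpDl// addr_ge0.
by rewrite le_eqVlt; apply/orP; left; apply/eqP; field.
Qed.

(** The value at h of an H2-smooth family is G 0 + h (U + r_h) with r_h small in
    H2, where U is the derivative at 0; the energy being quadratic, its
    difference quotient is energy1 (G 0) (U + r_h) up to O(h). *)
Lemma energy_is_derive delta (D : nat -> R -> R -> 'M[R]_n) :
  0 < delta -> (forall e, `|e| < delta -> H2_O (D 0%N e)) ->
  smooth_H2_jet delta D ->
  is_derive (0 : R) (1 : R) (fun e => energy lam c1 c2 (D 0%N e))
    (energy1 (D 0%N 0) (D 1%N 0)).
Proof.
move=> d0 OG DP; have z0 : `|0 : R| < delta by rewrite normr0.
set G := D 0%N in OG *.
have hg := (OG 0 z0).1; have [hU _] := DP 1%N 0 z0; set U := D 1%N 0 in hU *.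
have [C C0 CP] := energy_small hg.
pose r (h s : R) : 'M[R]_n := h^-1 *: (G h s - G 0 s) - U s.
have [_ r_cvg] := DP 0%N 0 z0; rewrite -/G -/U in r_cvg.
have rE h : (fun s => h^-1 *: (G (0 + h) s - G 0 s) - U s) = r h.
  by rewrite add0r.
have hr h : `|h| < delta -> H2_mx (r h).
  by move=> hd; exact: H2_mx_quotient (OG h hd).1 hg hU.
have GE h : h != 0 -> G h = (fun s => G 0 s + h *: (U s + r h s)).
  move=> h0; apply/funext => s; rewrite /r [U s + _]addrC subrK.
  by rewrite scalerA mulfV// scale1r addrC subrK.
have lU := contI_L1 (density2_cont hU).
pose K := \int[mu]_(s in unitI) density2 U s.
have density2_ge0 V s : 0 <= density2 V s by rewrite addr_ge0 ?ip_L_ge0 ?ip_o_ge0.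
have K0 : 0 <= K by apply: Rintegral_ge0.
apply/is_derive_cvg/cvgrPdist_le => e e0.
pose a := Num.min 1 (e / (2 * (C + 1))).
have C1 : 0 < C + 1 by rewrite ltr_wpDl.
have a0 : 0 < a by rewrite lt_min ltr01 divr_gt0// mulr_gt0.
have a1 : a <= 1 by rewrite ge_min lexx.
have Ca : C * a <= e / 2.
  have a2 : a <= e / (2 * (C + 1)) by rewrite ge_min lexx orbT.
  apply: (le_trans (ler_wpM2l C0 a2)).
  rewrite mulrA ler_pdivrMr ?mulr_gt0//.
  have -> : e / 2 * (2 * (C + 1)) = e * C + e by field.
  by rewrite mulrC lerDl ltW.
near=> h.
have h0 : h != 0 by near: h; exact: nbhs_dnbhs_neq.
have hd : `|h| < delta.
  by near: h; apply: dnbhs0_lt.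
have he : `|h| <= e / (2 * (K + C + 1)).
  near: h; apply: dnbhs0_le; rewrite divr_gt0// mulr_gt0// ltr_wpDl//.
  exact: addr_ge0.
have ra : H2_norm (r h) <= a.
  near: h; move/cvgrPdist_le : r_cvg => /(_ _ a0); apply: filterS => h.
  by rewrite rE sub0r normrN ger0_norm// H2_norm_ge0.
have hrh := hr h hd.
have [E1 E2] := CP _ _ hrh a0 a1 ra.
have hUr : H2_mx (fun s => U s + r h s).
  by have := (H2_mx_lin 1 hU hrh).1; congr H2_mx; apply/funext => s; rewrite scale1r.
rewrite addr0 !energy_quadratic; [|exact: OG|exact: OG].
rewrite [in X in density X](GE h h0) energyD// energy1D//.
pose M := \int[mu]_(s in unitI) density2 (fun s => U s + r h s) s.
have M0 : 0 <= M by apply: Rintegral_ge0.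
have MK : M <= 2 * (K + C).
  rewrite /M; apply: (@le_trans _ _ (\int[mu]_(s in unitI)
      (2 * density2 U s + 2 * density2 (r h) s))).
    apply: Rint_le; first exact/contI_L1/density2_cont.
      by apply: L1ID; apply: L1IZ => //; exact/contI_L1/density2_cont.
    by move=> s Is; exact: density2D.
  have lr := contI_L1 (density2_cont hrh).
  rewrite RintD; [|exact: L1IZ|exact: L1IZ].
  by rewrite !RintZ// mulrDr lerD2l ler_pM2l.
by apply: (quotient_estimate _ _ h0 _ M0 MK K0 C0 he) => //; exact: le_trans Ca.
Unshelve. all: by end_near.
Qed.

End first_variation.

(** * The Euler-Lagrange form of the first variation *)

Section matrix_product_rule.
Context {R : realType}.

Lemma derivI_mx_eq m n (A B : R -> 'M[R]_(m, n)) s : H2_mx B -> unitI s ->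
  (forall t, unitI t -> A t = B t) -> derivI_mx A s = derivI_mx B s.
Proof.
move=> hB Is AB; apply/matrixP => i j; rewrite !mxE.
apply: has_derivI_val => //.
apply: (has_derivI_eq (f := fun t => B t i j) Is) => [t It|]; first by rewrite AB.
by have [[H _] _] := H2_has_L2_deriv (hB i j); exact: H.
Qed.

Lemma H2_mx_tr m n (A : R -> 'M[R]_(m, n)) : H2_mx A ->
  H2_mx (fun s => (A s)^T) /\
  forall s, derivI_mx (fun s => (A s)^T) s = (derivI_mx A s)^T.
Proof.
move=> hA; split=> [i j|s].
  by under eq_fun do rewrite mxE; exact: hA.
by apply/matrixP => i j; rewrite !mxE; under eq_fun do rewrite mxE.
Qed.

Lemma H2_mx_mul m n p (A : R -> 'M[R]_(m, n)) (B : R -> 'M[R]_(n, p)) :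
  H2_mx A -> H2_mx B ->
  H2_mx (fun s => A s *m B s) /\ forall s, unitI s ->
    derivI_mx (fun s => A s *m B s) s =
    derivI_mx A s *m B s + A s *m derivI_mx B s.
Proof.
move=> hA hB.
have H i j := has_H2_sum (index_enum 'I_n) (fun l =>
  has_H2M (H2_has_L2_deriv (hA i l)) (H2_has_L2_deriv (hB l j))).
have E i j : (fun s => (A s *m B s) i j) = (fun s => \sum_l A s i l * B s l j).
  by apply/funext => s; rewrite mxE.
split=> [i j|s Is]; first by rewrite E; exact: has_H2_H2 (H i j).
apply/matrixP => i j; rewrite [LHS]mxE E (C1I_derivI (H i j).1 Is).
rewrite !mxE -big_split; apply: eq_bigr => l _ /=.
by rewrite !mxE.
Qed.

Lemma H2_mx_is_L2_deriv m n (A : R -> 'M[R]_(m, n)) : H2_mx A ->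
  is_L2_deriv_mx A (derivI_mx A).
Proof.
move=> hA i j; have := has_H2_is_L2_deriv (H2_has_L2_deriv (hA i j)).
by apply: is_L2_deriv_eq => // s _; rewrite mxE.
Qed.

Lemma trace_sym_antisym n (S X : 'M[R]_n) :
  S^T = S -> antisymmetric_mx X -> \tr (S *m X) = 0.
Proof.
move=> SS aX; have : \tr (S *m X) = - \tr (S *m X).
  by rewrite -{1}mxtrace_tr trmx_mul SS aX mulNmx raddfN /= mxtrace_mulC.
by move=> ?; lra.
Qed.

(** The functional that defines the diamond is the pairing with A L B^T, so its
    representative in o(n) is the antisymmetric part of that matrix. *)
Lemma diamond_flat n k (lam : 'rV[R]_k) (A B : 'M[R]_(n, k)) :
  diamond B (flat lam A) =
  2^-1 *: (A *m diag_mx lam *m B^T - B *m diag_mx lam *m A^T).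
Proof.
apply: is_diamond_uniq; first exact: diamondP.
set N := A *m _ *m _; have -> : B *m diag_mx lam *m A^T = N^T.
  by rewrite /N !trmx_mul trmxK tr_diag_mx mulmxA.
split.
  by rewrite /antisymmetric_mx linearZ /= linearB /= trmxK -scalerN opprB.
move=> Om aOm; rewrite /ip_o linearZ /= linearB /= trmxK -scalemxAl mxtraceZ.
rewrite mulmxBl linearB /=.
have -> : \tr (N *m Om) = - \tr (N^T *m Om).
  by rewrite -mxtrace_tr trmx_mul aOm mulNmx raddfN /= mxtrace_mulC.
have half (t : R) : 2^-1 * (t - - t) = t by field.
rewrite half.
rewrite /flat /ip_L /N !trmx_mul trmxK tr_diag_mx.
by rewrite -!mulmxA mxtrace_mulC !mulmxA.
Qed.

End matrix_product_rule.

Section euler_lagrange.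
Context {R : realType} {n k : nat}.
Variables (c1 c2 : R -> 'cV[R]_n) (lam : 'rV[R]_k).
Hypotheses (c1_Ck : CkI_mx k c1) (c2_Ck : CkI_mx k c2).
Variable g : R -> 'M[R]_n.
Hypothesis g_H2 : H2_O g.

Notation j1 s := (jet c1 s : 'M[R]_(n, k)).
Notation j2 s := (jet c2 s : 'M[R]_(n, k)).

(** The right-hand side of the Euler-Lagrange equation. *)
Definition force s : 'M[R]_n :=
  diamond (invmx (g s) *m j2 s) (flat lam (j1 s)).

Lemma force_antisym s : antisymmetric_mx (force s).
Proof. by case: (diamondP (invmx (g s) *m j2 s) (flat lam (j1 s))). Qed.

Lemma force_cont : contI_mx force.
Proof.
have [hg Og] := g_H2; have cg := H2_mx_cont hg.
have cj1 := contI_jet c1_Ck; have cj2 := contI_jet c2_Ck.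
pose B s := (g s)^T *m j2 s.
have cB : contI_mx B by apply: contI_mulmx => //; exact: contI_trmx.
have cd : contI_mx (fun=> diag_mx lam) by exact: contI_cstmx.
have cN : contI_mx (fun s => j1 s *m diag_mx lam *m (B s)^T -
    B s *m diag_mx lam *m (j1 s)^T).
  apply: contI_submx; (apply: contI_mulmx; last exact: contI_trmx).
    exact: contI_mulmx.
  exact: contI_mulmx.
move=> i j; have := contIM (@contI_cst R 2^-1) (cN i j).
apply: contI_eq => s Is.
by rewrite /force orthogonal_invmx ?diamond_flat; [rewrite [RHS]mxE|exact: Og].
Qed.

Lemma log_derivE s : unitI s -> log_deriv g s = (g s)^T *m derivI_mx g s.
Proof. by move=> Is; rewrite /log_deriv orthogonal_invmx//; exact: g_H2.2. Qed.

Lemma log_deriv_antisym s : unitI s -> antisymmetric_mx (log_deriv g s).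
Proof.
move=> Is; have [hg Og] := g_H2; have [htr dtr] := H2_mx_tr hg.
have := (H2_mx_mul htr hg).2 s Is.
rewrite (derivI_mx_eq (H2_mx_cst 1%:M) Is Og) dtr.
have -> : derivI_mx (fun=> 1%:M : 'M[R]_n) s = 0.
  apply/matrixP => i j; rewrite !mxE.
  exact: has_derivI_val (has_derivI_cst _ _).
move/esym/eqP; rewrite addr_eq0 => /eqP E.
rewrite /antisymmetric_mx log_derivE// trmx_mul trmxK.
exact: E.
Qed.

(** This makes the primitive of an entry of the logarithmic derivative an H2
    function, hence an admissible test function. *)
Lemma log_deriv_is_L2_deriv : is_L2_deriv_mx (log_deriv g) (fun s =>
  (derivI_mx g s)^T *m derivI_mx g s +
  (g s)^T *m \matrix_(i, j) L2_deriv (derivI (fun t => g t i j)) s).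
Proof.
have [hg _] := g_H2.
move=> i j.
have H := is_L2_deriv_sum (index_enum 'I_n) (fun l =>
  is_L2_derivM (has_H2_is_L2_deriv (H2_has_L2_deriv (hg l i)))
   (H2_has_L2_deriv (hg l j)).2).
apply: is_L2_deriv_eq H => s Is; first last.
  by rewrite !mxE -big_split; apply: eq_bigr => l _ /=; rewrite !mxE.
by rewrite log_derivE// mxE; apply: eq_bigr => l _; rewrite !mxE.
Qed.

(** Writing V = g X, the terms without X' drop out: each is the trace of a
    symmetric matrix times an antisymmetric one. *)
Lemma density1_tangent (V : R -> 'M[R]_n) s : H2_mx V -> unitI s ->
  antisymmetric_mx ((g s)^T *m V s) ->
  density1 c1 c2 lam g V s = ip_o (force s) ((g s)^T *m V s) +
    ip_o (log_deriv g s) ((derivI_mx g s)^T *m V s + (g s)^T *m derivI_mx V s).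
Proof.
move=> hV Is; have [hg Og] := g_H2.
have gg := Og s Is; have gg' := orthogonal_mul_tr gg.
set X := _ *m V s => aX.
have VE : V s = g s *m X by rewrite mulmxA gg' mul1mx.
clearbody X.
rewrite /density1; congr (_ + _).
  have [_ ->//] := diamondP (invmx (g s) *m j2 s) (flat lam (j1 s)).
  rewrite orthogonal_invmx// /flat.
  set A := j1 s; set B := (g s)^T *m j2 s.
  have -> : ip_L lam (g s *m A - j2 s) (V s *m A) =
      ip_L lam (A - B) (X *m A).
    have {1}-> : g s *m A - j2 s = g s *m (A - B).
      by rewrite mulmxBr [g s *m B]mulmxA gg' mul1mx.
    rewrite VE /ip_L trmx_mul !mulmxA -[_ *m (g s)^T *m g s]mulmxA.
    by rewrite gg mulmx1.
  clearbody A B; rewrite /ip_L linearB /= mulmxBr mulmxBl linearB /=.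
  have -> : \tr (diag_mx lam *m A^T *m (X *m A)) = 0.
    rewrite mulmxA mxtrace_mulC !mulmxA; apply: (trace_sym_antisym _ aX).
    by rewrite !trmx_mul trmxK tr_diag_mx mulmxA.
  rewrite sub0r -[in LHS]mxtrace_tr !trmx_mul aX tr_diag_mx trmxK.
  by rewrite mulmxN mulNmx linearN /= opprK !mulmxA mxtrace_mulC
    [RHS](_ : _ = ip_L lam A (X *m B))// /ip_L !mulmxA.
have dg : derivI_mx g s = g s *m log_deriv g s.
  by rewrite log_derivE// mulmxA gg' mul1mx.
set Om := log_deriv g s in dg *; have aOm : antisymmetric_mx Om.
  exact: log_deriv_antisym.
rewrite ip_oD {1}dg.
have -> : derivI_mx V s = g s *m ((g s)^T *m derivI_mx V s).
  by rewrite mulmxA gg' mul1mx.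
rewrite ip_o_orthogonal// [X in _ + ip_o _ X]mulmxA gg mul1mx.
have -> : (derivI_mx g s)^T *m V s = Om^T *m X.
  by rewrite dg VE trmx_mul -mulmxA [(g s)^T *m _]mulmxA gg mul1mx.
have -> : ip_o Om (Om^T *m X) = 0.
  rewrite /ip_o mulmxA; apply: (trace_sym_antisym _ aX).
  by rewrite trmx_mul trmxK aOm mulNmx mulmxN opprK.
by rewrite add0r.
Qed.

End euler_lagrange.

(** * Sufficiency of the Euler-Lagrange equation *)

Section sufficiency.
Context {R : realType} {n k : nat}.
Variables (c1 c2 : R -> 'cV[R]_n) (lam : 'rV[R]_k).
Hypotheses (c1_Ck : CkI_mx k c1) (c2_Ck : CkI_mx k c2).
Hypothesis lam_gt0 : forall i, 0 < lam 0 i.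
Variable g : R -> 'M[R]_n.
Hypothesis g_H2 : H2_O g.

(** H2 convergence of the difference quotients implies pointwise convergence, so
    the orthogonality relation can be differentiated at each s. *)
Lemma family_tangent delta (D : nat -> R -> R -> 'M[R]_n) :
  0 < delta -> (forall e, `|e| < delta -> H2_O (D 0%N e)) ->
  smooth_H2_jet delta D ->
  forall s, unitI s -> antisymmetric_mx ((D 0%N 0 s)^T *m D 1%N 0 s).
Proof.
move=> d0 OG DP s Is; have z0 : `|0 : R| < delta by rewrite normr0.
set G := D 0%N in OG *.
have hg := (OG 0 z0).1; have [hU _] := DP 1%N 0 z0; set U := D 1%N 0 in hU *.
have [_ r_cvg] := DP 0%N 0 z0; rewrite -/G -/U in r_cvg.
have dG i j : is_derive (0 : R) (1 : R) (fun h => G h s i j) (U s i j).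
  apply/is_derive_cvg/cvgrPdist_le => e e0.
  near=> h.
  have hd : `|h| < delta by near: h; exact: dnbhs0_lt.
  have re : H2_norm (fun s => h^-1 *: (G (0 + h) s - G 0 s) - U s) <= e / 2.
    near: h; have e20 : 0 < e / 2 by rewrite divr_gt0.
    move/cvgrPdist_le : r_cvg => /(_ _ e20); apply: filterS => h.
    by rewrite sub0r normrN ger0_norm// H2_norm_ge0.
  have hr : H2_mx (fun s => h^-1 *: (G (0 + h) s - G 0 s) - U s).
    by rewrite add0r; exact: H2_mx_quotient (OG h hd).1 hg hU.
  have B := H2_norm_sup i j hr Is.
  have -> : U s i j - h^-1 * (G (h + 0) s i j - G 0 s i j) =
      - (h^-1 *: (G (0 + h) s - G 0 s) - U s) i j.
    by rewrite !mxE add0r addr0 opprB.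
  by rewrite normrN; apply: (le_trans B); rewrite mulrC -ler_pdivlMr.
have dS i j := is_derive_sum (fun l => is_deriveM (dG l i) (dG l j)).
apply/matrixP => i j.
have E : is_derive (0 : R) (1 : R)
    (\sum_l ((fun h => G h s l i) * (fun h => G h s l j))) 0.
  apply: (@near_eq_is_derive _ _ _ (cst (1%:M i j : R))) => //.
  have : \forall h \near (0 : R), `|h| < delta by exact: nbhs0_lt.
  apply: filterS => h hd; have /matrixP/(_ i j) := (OG h hd).2 s Is.
  rewrite fct_sumE /cst => <-; rewrite mxE; apply: eq_bigr => l _.
  by rewrite mxE.
have := derive_val (is_derive := dS i j); rewrite (derive_val (is_derive := E)).
move=> /esym; rewrite big_split/= => /eqP; rewrite addr_eq0 => /eqP H.
rewrite [LHS]mxE [LHS]mxE [RHS]mxE [X in - X]mxE.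
transitivity (\sum_(l < n) G 0 s l j *: U s l i).
  by apply: eq_bigr => l _; rewrite mxE.
rewrite -[LHS]opprK -H; congr (- _).
by apply: eq_bigr => l _; rewrite mxE.
Unshelve. all: by end_near.
Qed.

(** The first variation is the integral of the derivative of <Om, X>, where Om is
    the logarithmic derivative and X = g^T U; it vanishes with Om at both ends. *)
Lemma euler_lagrange_critical (W : R -> 'M[R]_n) :
  is_L2_deriv_mx (log_deriv g) W ->
  {ae mu, forall s : R, unitI s -> W s = force c1 c2 lam g s} ->
  log_deriv g 0 = 0 -> log_deriv g 1 = 0 ->
  critical_point lam c1 c2 g.
Proof.
move=> OmW WD Om0 Om1 delta G d0 OG [D [D0 DP]] G0; subst G.
have z0 : `|0 : R| < delta by rewrite normr0.
have [hg Og] := g_H2.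
have [hU _] := DP 1%N 0 z0.
have := energy_is_derive c1_Ck c2_Ck lam_gt0 d0 OG DP.
have aX s : unitI s -> antisymmetric_mx ((g s)^T *m D 1%N 0 s).
  by move=> Is; rewrite -G0//; exact: family_tangent OG DP s Is.
set U := D 1%N 0 in hU aX *.
suff -> : energy1 c1 c2 lam (D 0%N 0) U = 0 by [].
have -> : energy1 c1 c2 lam (D 0%N 0) U = energy1 c1 c2 lam g U.
  apply: Rint_eq => s Is; rewrite /density1 G0//.
  by rewrite (derivI_mx_eq hg Is G0).
pose X s := (g s)^T *m U s.
pose X' s := (derivI_mx g s)^T *m U s + (g s)^T *m derivI_mx U s.
have [htr dtr] := H2_mx_tr hg.
have [hX dX] := H2_mx_mul htr hU.
have XX' : is_L2_deriv_mx X X'.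
  move=> i j; apply: is_L2_deriv_eq (H2_mx_is_L2_deriv hX i j) => // s Is.
  by rewrite dX// dtr.
have P := is_L2_deriv_sum (index_enum 'I_n) (fun i =>
  is_L2_deriv_sum (index_enum 'I_n) (fun j => is_L2_derivM (OmW i j) (XX' i j))).
have [lP /(_ 1 unitI1)] := P; rewrite Om0 Om1.
rewrite [LHS]big1 => [|i _]; last by rewrite big1// => j _; rewrite mxE mul0r.
rewrite [X in X + _]big1 => [|i _]; last by rewrite big1// => j _; rewrite mxE mul0r.
rewrite add0r => /esym <-.
rewrite /energy1 /Rintegral; congr fine; apply: ae_eq_integral.
- exact: measurable_unitI.
- apply/measurable_EFinP; exact: (contI_meas (density1_cont c1_Ck c2_Ck hg hU)).
- apply/measurable_EFinP; case: lP => mP _; exact: mP.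
- apply: filterS WD; first exact: (ae_filter_ringOfSetsType mu).
  move=> s WDs Is; congr EFin.
  rewrite (density1_tangent c1 c2 lam g_H2 hU Is (aX s Is)) -WDs// !ip_oE.
  rewrite -big_split; apply: eq_bigr => i _ /=; rewrite -big_split.
  by apply: eq_bigr => j _.
Qed.

End sufficiency.

(** * Families of rotations *)

Section trigonometric_remainder.
Context {R : realType}.
Implicit Types (x y d e h M : R) (j : nat).

(** The j-th derivative of the sine. *)
Definition dsin j x : R := sin (x + j%:R * (pi / 2)).

Lemma is_derive_dsin j x : is_derive x (1 : R) (dsin j) (dsin j.+1 x).
Proof.
have -> : dsin j.+1 x = cos (x + j%:R * (pi / 2)) * 1.
  by rewrite mulr1 -sinDpihalf /dsin -natr1 mulrDl mul1r addrA.
rewrite /dsin.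
have H : is_derive x (1 : R) (fun y : R => y + j%:R * (pi / 2)) 1.
  by apply: is_derive_eq; rewrite addr0.
exact: (@is_derive1_comp R sin (fun y : R => y + j%:R * (pi / 2))).
Qed.

Lemma dsin_le1 j x : `|dsin j x| <= 1.
Proof. by rewrite ler_norml sin_geN1 sin_le1. Qed.

Lemma continuous_dsin j : continuous (dsin j).
Proof.
by move=> x; exact: is_derive_continuous (is_derive_dsin j x).
Qed.

Lemma mean_value_bound (f f' : R -> R) C d :
  (forall x : R, is_derive x (1 : R) f (f' x)) ->
  (forall x, `|x| <= `|d| -> `|f' x| <= C) -> `|f d - f 0| <= C * `|d|.
Proof.
move=> df f'C.
have cf x : {for x, continuous f}.
  exact: is_derive_continuous (df x).
have [d0|/ltW d0] := leP 0 d.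
  have [|c] := @MVT_segment R f f' 0 d d0 (fun x _ => df x).
    by apply: continuous_subspaceT => x; exact: cf.
  rewrite in_itv/= => /andP[c0 cd] ->; rewrite subr0 normrM ler_wpM2r//.
  by apply: f'C; rewrite !ger0_norm.
have [|c] := @MVT_segment R f f' d 0 d0 (fun x _ => df x).
  by apply: continuous_subspaceT => x; exact: cf.
rewrite in_itv/= => /andP[c0 cd]; rewrite distrC => ->.
rewrite sub0r normrM normrN ler_wpM2r//.
by apply: f'C; rewrite !ler0_norm// lerN2.
Qed.

Lemma is_derive_shift_dsin j y x :
  is_derive x (1 : R) (fun t => dsin j (y + t)) (dsin j.+1 (y + x)).
Proof.
rewrite -[X in is_derive _ _ _ X]mulr1.
have H : is_derive x (1 : R) (fun t : R => y + t) 1.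
  have := is_deriveD (is_derive_cst y x 1) (is_derive_id x (1 : R)).
  by rewrite add0r.
have H' := is_derive_dsin j (y + x).
exact: (@is_derive1_comp R (dsin j) (fun t => y + t)).
Qed.

Lemma dsin_lipschitz j y d : `|dsin j (y + d) - dsin j y| <= `|d|.
Proof.
have := mean_value_bound (is_derive_shift_dsin j y) (C := 1) (d := d).
by rewrite addr0 mul1r; apply => x _; exact: dsin_le1.
Qed.

Lemma dsin_taylor j y d :
  `|dsin j (y + d) - dsin j y - d * dsin j.+1 y| <= d ^+ 2.
Proof.
pose f t := dsin j (y + t) + t * - dsin j.+1 y.
pose f' t := dsin j.+1 (y + t) + - dsin j.+1 y.
have df x : is_derive x (1 : R) f (f' x).
  have H := is_derive_shift_dsin j y x.
  have H2 : is_derive x (1 : R) (fun t : R => t * - dsin j.+1 y) (- dsin j.+1 y).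
    have := is_deriveM (is_derive_id x (1 : R)) (is_derive_cst (- dsin j.+1 y) x 1).
    by rewrite scaler0 add0r [_ *: _]mulr1.
  exact: is_deriveD.
have := mean_value_bound df (C := `|d|) (d := d).
rewrite /f addr0 mul0r addr0 -expr2 real_normK ?num_real// mulrN addrAC; apply.
by move=> x /(le_trans _); apply; exact: dsin_lipschitz.
Qed.

Definition dsin_incr e h j x : R := dsin j ((e + h) * x) - dsin j (e * x).

(** The error in differentiating dsin j (e x) with respect to e. *)
Definition dsin_rem e h j x : R := h^-1 * dsin_incr e h j x - x * dsin j.+1 (e * x).

Lemma is_derive_scale_dsin j a x :
  is_derive x (1 : R) (fun t => dsin j (a * t)) (a * dsin j.+1 (a * x)).
Proof.
have H : is_derive x (1 : R) (fun t : R => a * t) a.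
  have := is_deriveM (is_derive_cst a x 1) (is_derive_id x (1 : R)).
  by rewrite scaler0 addr0 [_ *: _]mulr1.
have H' := is_derive_dsin j (a * x); rewrite mulrC.
exact: (@is_derive1_comp R (dsin j) (fun t => a * t)).
Qed.

Lemma is_derive_dsin_incr e h j x : is_derive x (1 : R) (dsin_incr e h j)
  (e * dsin_incr e h j.+1 x + h * dsin j.+1 ((e + h) * x)).
Proof.
have H1 := is_derive_scale_dsin j (e + h) x.
have H2 := is_derive_scale_dsin j e x.
apply: (is_derive_eq (is_deriveB H1 H2)).
by rewrite /dsin_incr; ring.
Qed.

Lemma is_derive_dsin_rem e h j x : h != 0 ->
  is_derive x (1 : R) (dsin_rem e h j)
    (dsin_incr e h j.+1 x + e * dsin_rem e h j.+1 x).
Proof.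
move=> h0.
have H1 := is_derive_dsin_incr e h j x.
have H2 := is_derive_scale_dsin j.+1 e x.
have H1' := is_deriveZ h^-1 H1.
have H2' := is_deriveM (is_derive_id x (1 : R)) H2.
apply: (is_derive_eq (is_deriveB H1' H2')).
by rewrite /dsin_rem /dsin_incr /GRing.scale /=; field.
Qed.

(** The second derivative of dsin_rem e h j, for h != 0. *)
Definition dsin_rem'' e h j x : R :=
  e * dsin_incr e h j.+2 x + h * dsin j.+2 ((e + h) * x) +
  e * (dsin_incr e h j.+2 x + e * dsin_rem e h j.+2 x).

Lemma is_derive_dsin_rem' e h j x : h != 0 ->
  is_derive x (1 : R) (fun y => dsin_incr e h j.+1 y + e * dsin_rem e h j.+1 y)
    (dsin_rem'' e h j x).
Proof.
move=> h0.
have H1 := is_derive_dsin_incr e h j.+1 x.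
have H2 := is_deriveZ e (is_derive_dsin_rem e j.+1 x h0).
exact: is_deriveD.
Qed.

Lemma dsin_incr_bound e h j x M : `|x| <= M -> `|dsin_incr e h j x| <= `|h| * M.
Proof.
move=> xM; rewrite /dsin_incr mulrDl (le_trans (dsin_lipschitz _ _ _))//.
by rewrite normrM ler_wpM2l.
Qed.

Lemma dsin_rem_bound e h j x M : h != 0 -> `|x| <= M ->
  `|dsin_rem e h j x| <= `|h| * M ^+ 2.
Proof.
move=> h0 xM.
have -> : dsin_rem e h j x =
    h^-1 * (dsin j (e * x + h * x) - dsin j (e * x) - h * x * dsin j.+1 (e * x)).
  by rewrite /dsin_rem /dsin_incr mulrDl; field.
rewrite normrM normfV ler_pdivrMl ?normr_gt0// (le_trans (dsin_taylor _ _ _))//.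
rewrite exprMn -[h ^+ 2]real_normK ?num_real// [`|h| ^+ 2]expr2 -mulrA.
rewrite !ler_wpM2l//.
by rewrite -[x ^+ 2]real_normK ?num_real// lerXn2r ?nnegrE// (le_trans _ xM).
Qed.

(** The remainder and its first two derivatives are O(h), uniformly on bounded
    sets. *)
Lemma dsin_rem_small e j M : 0 <= M -> exists2 K, 0 <= K &
  forall h x, h != 0 -> `|x| <= M ->
  [/\ `|dsin_rem e h j x| <= `|h| * K,
      `|dsin_incr e h j.+1 x + e * dsin_rem e h j.+1 x| <= `|h| * K &
      `|dsin_rem'' e h j x| <= `|h| * K].
Proof.
(* one summand for each of the three bounds *)
move=> M0; exists (M ^+ 2 + (M + `|e| * M ^+ 2) + (2 * `|e| * M + 1 + `|e| ^+ 2 * M ^+ 2)).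
  by rewrite !addr_ge0 ?mulr_ge0 ?sqr_ge0.
move=> h x h0 xM.
have i1 := dsin_incr_bound e h j.+1 xM; have i2 := dsin_incr_bound e h j.+2 xM.
have r0 := dsin_rem_bound e j h0 xM; have r1 := dsin_rem_bound e j.+1 h0 xM.
have r2 := dsin_rem_bound e j.+2 h0 xM.
have e0 := normr_ge0 e; have hh := normr_ge0 h.
have s2 := sqr_ge0 M; have eM := mulr_ge0 e0 M0; have eM2 := mulr_ge0 e0 s2.
have e2M2 := mulr_ge0 (sqr_ge0 `|e|) s2.
split.
- apply: (le_trans r0); rewrite ler_wpM2l//; lra.
- apply: (le_trans (ler_normD _ _)); rewrite normrM.
  apply: (@le_trans _ _ (`|h| * (M + `|e| * M ^+ 2))); last by rewrite ler_wpM2l//; lra.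
  rewrite mulrDr lerD// mulrCA ler_wpM2l//.
- apply: (@le_trans _ _ (`|h| * (2 * `|e| * M + 1 + `|e| ^+ 2 * M ^+ 2))); last first.
    by rewrite ler_wpM2l//; lra.
  rewrite /dsin_rem''.
  apply: (le_trans (ler_normD _ _)); rewrite normrM.
  apply: (le_trans (lerD (ler_normD _ _) (ler_wpM2l e0 (ler_normD _ _)))).
  rewrite !normrM.
  have a1 := ler_wpM2l e0 i2; have a2 := ler_wpM2l e0 (ler_wpM2l e0 r2).
  have a3 := ler_wpM2l hh (dsin_le1 j.+2 ((e + h) * x)).
  have -> : `|h| * (2 * `|e| * M + 1 + `|e| ^+ 2 * M ^+ 2) =
    2 * (`|e| * (`|h| * M)) + `|h| * 1 + `|e| * (`|e| * (`|h| * M ^+ 2)) by ring.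
  rewrite mulrDr; lra.
Qed.

End trigonometric_remainder.

Section H2_majorants.
Context {R : realType}.
Implicit Types (f u v w m b p : R -> R) (c : R).

(** For m in L2 this bounds the H2 norm of u by a multiple of c; a pointwise
    majorant adds up under sums and can be read off from explicit derivatives. *)
Definition H2_le u c m := exists v w, has_H2 u v w /\ forall s, unitI s ->
  [/\ `|u s| <= c * m s, `|v s| <= c * m s & `|w s| <= c * m s].

Lemma H2_leD u u' c m m' : H2_le u c m -> H2_le u' c m' ->
  H2_le (fun s => u s + u' s) c (fun s => m s + m' s).
Proof.
move=> [v [w [H B]]] [v' [w' [H' B']]].
exists (fun s => v s + v' s), (fun s => w s + w' s); split; first exact: has_H2D.
move=> s Is; have [b0 b1 b2] := B s Is; have [b0' b1' b2'] := B' s Is.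
by rewrite mulrDr; split; apply: (le_trans (ler_normD _ _)); exact: lerD.
Qed.

Lemma H2_le_sqnorm u c m : L2I m -> H2_le u c m ->
  H2_sqnorm u <= c ^+ 2 * (3 * \int[mu]_(s in unitI) (m s ^+ 2)).
Proof.
move=> lm [v [w [H B]]]; have [l ->] := has_H2_sqnorm H.
have l2 := L2I_sqr lm.
rewrite -RintZ// -RintZ; last exact: L1IZ.
apply: Rint_le => //; first by do 2 apply: L1IZ.
have sq (x y : R) : `|x| <= y -> x ^+ 2 <= y ^+ 2.
  move=> xy; rewrite -[x ^+ 2]real_normK ?num_real//.
  by rewrite lerXn2r ?nnegrE// (le_trans _ xy).
move=> s /B[/sq b0 /sq b1 /sq b2]; move: b0 b1 b2; rewrite exprMn; lra.
Qed.

Lemma H2_le_eq u u' c m : (forall s, unitI s -> u s = u' s) ->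
  H2_le u c m -> H2_le u' c m.
Proof.
move=> uu [v [w [H B]]]; exists v, w; split; first exact: has_H2_eq H.
by move=> s Is; rewrite -uu//; exact: B.
Qed.

(** Second-order chain and product rules: the outer function enters only through
    its values and those of its first two derivatives. *)
Lemma H2_le_comp b p : H2 b -> H2 p -> exists2 m, L2I m &
  forall (r r' r'' : R -> R) c,
  (forall x : R, is_derive x (1 : R) r (r' x)) ->
  (forall x : R, is_derive x (1 : R) r' (r'' x)) -> continuous r'' -> 0 <= c ->
  (forall s, unitI s ->
    [/\ `|r (p s)| <= c, `|r' (p s)| <= c & `|r'' (p s)| <= c]) ->
  H2_le (fun s => b s * r (p s)) c m.
Proof.
move=> /H2_has[w Hb] /H2_has[q Hp].
move: Hb Hp; set b' := derivI b; set p' := derivI p => Hb Hp.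
have [[cb' lw] [cp' lq]] := (Hb, Hp).
have cb := C1I_cont cb'; have cp := C1I_cont cp'.
pose m s := `|b s| + (`|b' s| + `|b s * p' s|) + (`|w s| + 2 * `|b' s * p' s| +
  `|b s * p' s * p' s| + `|b s * q s|).
exists m.
  have cbp : {within unitI, continuous (fun s => b s * p' s)}.
    by apply: contIM => //; exact: cp'.2.
  have c1 : {within unitI, continuous (fun s => `|b s| + (`|b' s| + `|b s * p' s|))}.
    by apply: contID; [|apply: contID]; apply: contI_abs => //; exact: cb'.2.
  apply: L2ID; first exact: contI_L2.
  apply: L2ID; last by apply/L2I_abs/L2I_contM => //; exact: is_L2_deriv_L2 lq.
  apply: L2ID; last first.
    by apply/contI_L2/contI_abs/contIM => //; exact: cp'.2.
  apply: L2ID; first by apply/L2I_abs; exact: is_L2_deriv_L2 lw.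
  apply/contI_L2/contIM; first exact: contI_cst.
  by apply/contI_abs/contIM; [exact: cb'.2|exact: cp'.2].
move=> r r' r'' c dr dr' cr'' c0 B.
have H := has_H2M Hb (has_H2_comp dr dr' cr'' Hp).
eexists; eexists; split; first exact: H.
move=> s /B[]; set x := r _; set x' := r' _; set x'' := r'' _ => Bx Bx' Bx''.
have bd (y z : R) : `|z| <= c -> `|y * z| <= c * `|y|.
  by move=> zc; rewrite normrM mulrC ler_wpM2r.
have n0 := normr_ge0 (b s); have n1 := normr_ge0 (b' s).
have n2 := normr_ge0 (b s * p' s); have n3 := normr_ge0 (w s).
have n4 := normr_ge0 (b' s * p' s); have n5 := normr_ge0 (b s * p' s * p' s).
have n6 := normr_ge0 (b s * q s).
split.
- apply: (le_trans (bd _ _ Bx)); rewrite ler_wpM2l// /m; lra.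
- apply: (@le_trans _ _ (c * (`|b' s| + `|b s * p' s|))); last first.
    by rewrite ler_wpM2l// /m; lra.
  rewrite (_ : b s * (x' * p' s) = (b s * p' s) * x'); last by ring.
  by rewrite (le_trans (ler_normD _ _))// mulrDr lerD// bd.
- apply: (@le_trans _ _ (c * (`|w s| + 2 * `|b' s * p' s| +
      `|b s * p' s * p' s| + `|b s * q s|))); last first.
    by rewrite ler_wpM2l// /m; lra.
  have -> : w s * x + b' s * (x' * p' s) + (b' s * (x' * p' s) +
      b s * (x'' * p' s * p' s + x' * q s)) =
      w s * x + 2 * (b' s * p' s * x') + b s * p' s * p' s * x'' + b s * q s * x'.
    by ring.
  rewrite !mulrDr (le_trans (ler_normD _ _))// lerD ?bd//.
  rewrite (le_trans (ler_normD _ _))// lerD ?bd//.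
  rewrite (le_trans (ler_normD _ _))// lerD ?bd//.
  by rewrite normrM ger0_norm// mulrCA ler_wpM2l// bd.
Qed.

End H2_majorants.

Section H2_algebra.
Context {R : realType}.
Implicit Types (f u : R -> R).

Lemma H2D f u : H2 f -> H2 u -> H2 (fun s => f s + u s).
Proof. by move=> /H2_has[w H] /H2_has[w' H']; exact: has_H2_H2 (has_H2D H H'). Qed.

Lemma H2M f u : H2 f -> H2 u -> H2 (fun s => f s * u s).
Proof. by move=> /H2_has[w H] /H2_has[w' H']; exact: has_H2_H2 (has_H2M H H'). Qed.

Lemma H2_cst (a : R) : H2 (fun _ : R => a).
Proof. exact: has_H2_H2 (has_H2_cst a). Qed.

Lemma H2X f j : H2 f -> H2 (fun s => f s ^+ j).
Proof.
move=> hf; elim: j => [|j IH].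
  by under eq_fun do rewrite expr0; exact: H2_cst.
by under eq_fun do rewrite exprS; exact: H2M.
Qed.

Lemma H2_dsin f j e : H2 f -> H2 (fun s => dsin j (e * f s)).
Proof.
move=> /H2_has[w H].
exact: has_H2_H2 (has_H2_comp (is_derive_dsin j) (is_derive_dsin j.+1)
  (@continuous_dsin R j.+2) (has_H2Z e H)).
Qed.

End H2_algebra.

Section rotations.
Context {R : realType} {n : nat}.
Variables (g : R -> 'M[R]_n) (K K2 : 'M[R]_n) (phi : R -> R).
Hypotheses (g_H2 : H2_O g) (phi_H2 : H2 phi).
Hypotheses (K_anti : antisymmetric_mx K) (K_sqr : K *m K = K2).
Hypothesis K_cube : K2 *m K = - K.

(** For j = 0 this is g exp(e phi K), as K^3 = - K, and for other j its j-th
    derivative with respect to e. *)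
Definition rot j (e s : R) : 'M[R]_n :=
  ((j == 0%N)%:R *: (g s *m (1%:M + K2)) +
    (phi s ^+ j * dsin j (e * phi s)) *: (g s *m K)) -
    (phi s ^+ j * dsin j.+1 (e * phi s)) *: (g s *m K2).

Lemma rot_entry j e s a b : rot j e s a b =
  (j == 0%N)%:R * (g s *m (1%:M + K2)) a b +
  (g s *m K) a b * phi s ^+ j * dsin j (e * phi s) +
  -1 * ((g s *m K2) a b * phi s ^+ j * dsin j.+1 (e * phi s)).
Proof.
have E (A B C : 'M[R]_n) (x y z : R) :
    (x *: A + y *: B - z *: C) a b = x * A a b + y * B a b - z * C a b.
  by rewrite !mxE.
by rewrite /rot E; ring.
Qed.

Lemma H2_gM (A : 'M[R]_n) : H2_mx (fun s => g s *m A).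
Proof. exact: (H2_mx_mul g_H2.1 (H2_mx_cst A)).1. Qed.

Lemma rot_H2 j e : H2_mx (rot j e).
Proof.
move=> a b; under eq_fun do rewrite rot_entry.
apply: H2D; first apply: H2D.
- by apply: H2M; [exact: H2_cst|exact: H2_gM].
- apply: H2M; last exact: H2_dsin.
  by apply: H2M; [exact: H2_gM|exact: H2X].
- apply: H2M; first exact: H2_cst.
  apply: H2M; last exact: H2_dsin.
  by apply: H2M; [exact: H2_gM|exact: H2X].
Qed.

(** With K^4 = - K^2, a = sin and b = 1 - cos, the product of the rotation with its
    transpose is 1 + (2 b - a^2 - b^2) K^2, and the bracket vanishes. *)
Lemma rot_orthogonal e s : unitI s -> orthogonal_mx (rot 0 e s).
Proof.
move=> Is; set a := dsin 0 (e * phi s); set c := dsin 1 (e * phi s).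
have ac : a ^+ 2 + c ^+ 2 = 1.
  rewrite /a /c /dsin mul0r addr0 mul1r sinDpihalf.
  by rewrite addrC cos2Dsin2.
have E (O A B : 'M[R]_n) (x y : R) :
    O + A + x *: B - y *: A = O + x *: B + (1 - y) *: A.
  by apply/matrixP => i j; rewrite !mxE; ring.
have -> : rot 0 e s = g s *m (1%:M + a *: K + (1 - c) *: K2).
  rewrite /rot eqxx scale1r !expr0 !mul1r -/a -/c.
  rewrite !scalemxAr -mulmxDr -mulmxBr; congr (_ *m _); exact: E.
have KK2 : K *m K2 = - K by rewrite -K_sqr mulmxA K_sqr.
have K22 : K2 *m K2 = - K2 by rewrite -{1}K_sqr -mulmxA KK2 mulmxN K_sqr.
have K2t : K2^T = K2 by rewrite -K_sqr trmx_mul K_anti mulNmx mulmxN opprK.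
rewrite /orthogonal_mx trmx_mul mulmxA -[_ *m (g s)^T *m _]mulmxA.
rewrite (g_H2.2 s Is) mulmx1 !linearD /= !linearZ /= trmx1 K2t K_anti.
set b := 1 - c.
rewrite !mulmx1 !mulmxDl !mul1mx -!scalemxAl.
rewrite !mulNmx KK2 K_cube K22 K_sqr.
have bE : 2 * b - a ^+ 2 - b ^+ 2 = 0.
  by rewrite (_ : a ^+ 2 = 1 - c ^+ 2) ?/b; [ring|rewrite -ac addrK].
apply/matrixP => i j; rewrite !mxE.
have : (2 * b - a ^+ 2 - b ^+ 2) * K2 i j = 0 by rewrite bE mul0r.
set x := K2 i j; set y := K i j; set z : R := _%:R.
by move=> H; rewrite -[RHS]addr0 -H; ring.
Qed.

Lemma rot_remainder j e h s a b :
  (h^-1 *: (rot j (e + h) s - rot j e s) - rot j.+1 e s) a b =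
  (g s *m K) a b * phi s ^+ j * dsin_rem e h j (phi s) +
  -1 * ((g s *m K2) a b) * phi s ^+ j * dsin_rem e h j.+1 (phi s).
Proof.
have E (A B C : 'M[R]_n) (x : R) :
    (x *: (A - B) - C) a b = x * (A a b - B a b) - C a b.
  by rewrite !mxE.
rewrite E !rot_entry.
by rewrite /dsin_rem /dsin_incr exprS /=; ring.
Qed.

(** The remainder of each entry combines two fixed H2 functions, with remainders of
    the sine at phi as coefficients, and phi is bounded. *)
Lemma rot_smooth_entry j e a b : exists2 C, 0 <= C &
  forall h, h != 0 -> H2_sqnorm (fun s =>
    (h^-1 *: (rot j (e + h) s - rot j e s) - rot j.+1 e s) a b) <= h ^+ 2 * C.
Proof.
have [M M0 pM] := contI_bounded (C1I_cont (H2_has_L2_deriv phi_H2).1).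
have h1 : H2 (fun s => (g s *m K) a b * phi s ^+ j).
  by apply: H2M; [exact: H2_gM|exact: H2X].
have h2 : H2 (fun s => -1 * ((g s *m K2) a b) * phi s ^+ j).
  apply: H2M; last exact: H2X.
  by apply: H2M; [exact: H2_cst|exact: H2_gM].
have [m1 lm1 P1] := H2_le_comp h1 phi_H2.
have [m2 lm2 P2] := H2_le_comp h2 phi_H2.
have [K1 K10 B1] := dsin_rem_small e j (ltW M0).
have [K3 K30 B3] := dsin_rem_small e j.+1 (ltW M0).
pose c := K1 + K3; have lm := L2ID lm1 lm2.
exists (c ^+ 2 * (3 * \int[lebesgue_measure]_(s in unitI) ((m1 s + m2 s) ^+ 2))).
  rewrite mulr_ge0 ?sqr_ge0// mulr_ge0//; apply: Rintegral_ge0 => s _.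
  exact: sqr_ge0.
move=> h h0.
have cont_rem i : continuous (dsin_rem'' e h i).
  move=> x; apply: cvgD; first apply: cvgD.
  - apply: cvgM; first exact: cvg_cst.
    exact: is_derive_continuous (is_derive_dsin_incr e h i.+2 x).
  - apply: cvgM; first exact: cvg_cst.
    exact: is_derive_continuous (is_derive_scale_dsin i.+2 (e + h) x).
  - apply: cvgM; first exact: cvg_cst.
    apply: cvgD; last (apply: cvgM; first exact: cvg_cst).
      exact: is_derive_continuous (is_derive_dsin_incr e h i.+2 x).
    exact: is_derive_continuous (is_derive_dsin_rem e i.+2 x h0).
rewrite mulrA -[h ^+ 2]real_normK ?num_real// -exprMn; apply: (H2_le_sqnorm lm).
have hc : 0 <= `|h| * c by rewrite mulr_ge0// addr_ge0.
have le1 : `|h| * K1 <= `|h| * c by rewrite ler_wpM2l// lerDl.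
have le3 : `|h| * K3 <= `|h| * c by rewrite ler_wpM2l// lerDr.
apply: H2_le_eq (H2_leD (P1 _ _ _ _ (fun x => is_derive_dsin_rem e j x h0)
   (fun x => is_derive_dsin_rem' e j x h0) (cont_rem j) hc _)
  (P2 _ _ _ _ (fun x => is_derive_dsin_rem e j.+1 x h0)
   (fun x => is_derive_dsin_rem' e j.+1 x h0) (cont_rem j.+1) hc _)).
- by move=> s _; rewrite rot_remainder.
- by move=> s /pM pMs; have [? ? ?] := B1 h _ h0 pMs; split; apply: le_trans le1.
- by move=> s /pM pMs; have [? ? ?] := B3 h _ h0 pMs; split; apply: le_trans le3.
Qed.

Lemma rot_smooth j e : H2_norm (fun s =>
    h^-1 *: (rot j (e + h) s - rot j e s) - rot j.+1 e s)
  @[h --> (0 : R)^'] --> (0 : R).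
Proof.
have /choice[C CP] (ab : 'I_n * 'I_n) : exists C, 0 <= C /\ forall h, h != 0 ->
    H2_sqnorm (fun s => (h^-1 *: (rot j (e + h) s - rot j e s) -
      rot j.+1 e s) ab.1 ab.2) <= h ^+ 2 * C.
  by have [C C0 P] := rot_smooth_entry j e ab.1 ab.2; exists C.
pose S := \sum_a \sum_b C (a, b).
have S0 : 0 <= S.
  by apply: sumr_ge0 => a _; apply: sumr_ge0 => b _; exact: (CP _).1.
have bound h : h != 0 -> H2_norm (fun s =>
    h^-1 *: (rot j (e + h) s - rot j e s) - rot j.+1 e s) <= `|h| * Num.sqrt S.
  move=> h0; rewrite -[`|h|]sqrtr_sqr -sqrtrM ?sqr_ge0// /H2_norm.
  rewrite ler_wsqrtr// mulr_sumr.
  apply: ler_sum => a _; rewrite mulr_sumr; apply: ler_sum => b _.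
  exact: (CP (a, b)).2.
apply/cvgrPdist_le => d d0; near=> h.
rewrite sub0r normrN ger0_norm ?H2_norm_ge0//.
have h0 : h != 0 by near: h; exact: nbhs_dnbhs_neq.
apply: (le_trans (bound h h0)).
have S1 : 0 < Num.sqrt S + 1 by rewrite ltr_wpDl// sqrtr_ge0.
have hd : `|h| <= d / (Num.sqrt S + 1).
  by near: h; apply: dnbhs0_le; rewrite divr_gt0.
apply: (@le_trans _ _ (`|h| * (Num.sqrt S + 1))).
  by rewrite ler_wpM2l// lerDl.
by rewrite -ler_pdivlMr.
Unshelve. all: by end_near.
Qed.

Lemma rot00 s : rot 0 0 s = g s.
Proof.
rewrite /rot eqxx scale1r !expr0 !mul1r !mul0r /dsin mul0r addr0 sin0 scale0r.
by rewrite addr0 mul1r sinDpihalf cos0 scale1r mulmxDr mulmx1 addrK.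
Qed.

Lemma rot10 s : rot 1 0 s = phi s *: (g s *m K).
Proof.
rewrite /rot scale0r add0r !expr1 !mul0r /dsin mul1r sinDpihalf cos0 mulr1.
have -> : 0 + 2%:R * (pi / 2) = pi :> R by rewrite add0r; field.
by rewrite sinpi mulr0 scale0r subr0.
Qed.

End rotations.

(** * Necessity of the Euler-Lagrange equation *)

Section du_bois_reymond.
Context {R : realType}.
Implicit Types (p o q v w phi : R -> R).

(** With P the primitive of p vanishing at 0 and q := o - P, testing against the
    constant 1 gives P 1 = 0, and then testing against the primitive of q makes
    the integral of q^2 vanish. *)
Lemma du_bois_reymond p o o' : contI p -> is_L2_deriv o o' ->
  (forall phi v w, has_H2 phi v w ->
    \int[mu]_(s in unitI) (p s * phi s + o s * v s) = 0) ->
  [/\ is_L2_deriv o p, o 0 = 0 & o 1 = 0].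
Proof.
move=> cp oo' weak.
have Pp := C1I_int cp; have Pp2 := C1I_is_L2_deriv Pp.
set P := (fun t => \int[mu]_(s in `[0, t]) p s) in Pp Pp2.
have P0 : P 0 = 0 by rewrite /P set_itv1 Rintegral_set1.
have P1 : P 1 = 0.
  rewrite -[RHS](weak _ _ _ (has_H2_cst 1)); apply: Rint_eq => s _.
  by rewrite mulr1 mulr0 addr0.
pose q s := o s + -1 * P s.
have qq' : is_L2_deriv q (fun s => o' s + -1 * p s).
  by apply: is_L2_derivD => //; exact: is_L2_derivZ.
have cq := is_L2_deriv_cont qq'; have co := is_L2_deriv_cont oo'.
have cP := C1I_cont Pp.
have Fq := C1I_int cq.
set F := (fun t => \int[mu]_(s in `[0, t]) q s) in Fq.
have HF : has_H2 F q (fun s => o' s + -1 * p s) by [].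
have cF := C1I_cont Fq.
have := (is_L2_derivM Pp2 (C1I_is_L2_deriv Fq)).2 1 unitI1.
rewrite P0 P1 !mul0r add0r => PF.
have oF := weak _ _ _ HF.
have q2 : \int[mu]_(s in unitI) (q s ^+ 2) = 0.
  transitivity (\int[mu]_(s in unitI) (p s * F s + o s * q s) -
      \int[mu]_(s in unitI) (p s * F s + P s * q s)).
    rewrite -RintB; [|by apply/contI_L1/contID; exact: contIM..].
    by apply: Rint_eq => s _; rewrite /q; ring.
  by rewrite oF -PF subrr.
have q0 s : unitI s -> o s = P s.
  move=> Is; have cq2 : contI (fun s => q s ^+ 2) by exact: contIX.
  have := Rint_ge0_eq0 cq2 (fun s _ => sqr_ge0 _) q2 Is.
  by move/eqP; rewrite sqrf_eq0 /q mulN1r subr_eq0 => /eqP.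
split.
- by apply: is_L2_deriv_eq Pp2 => // s /q0.
- by rewrite q0//; exact: unitI0.
- by rewrite q0//; exact: unitI1.
Qed.

End du_bois_reymond.

Section elementary_rotation.
Context {R : realType} {n : nat}.
Implicit Types i j : 'I_n.

Definition elem_antisym i j : 'M[R]_n := delta_mx i j - delta_mx j i.

Lemma elem_antisymP i j : antisymmetric_mx (elem_antisym i j).
Proof.
by rewrite /antisymmetric_mx linearB /= !trmx_delta opprB.
Qed.

(** For i <> j the matrix generates the rotations of a coordinate plane, on which
    its square is minus the identity. *)
Lemma elem_antisym_cube i j :
  elem_antisym i j *m elem_antisym i j *m elem_antisym i j = - elem_antisym i j.
Proof.
rewrite /elem_antisym; have [->|ij] := eqVneq i j.
  by rewrite subrr !mul0mx oppr0.
rewrite !(mulmxBl, mulmxBr) !mul_delta_mx_cond !eqxx (negPf ij) eq_sym (negPf ij).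
rewrite !mulr0n !mulr1n !(mulmxBl, mulmxBr, mul0mx, subr0, sub0r).
rewrite !mul_delta_mx_cond !eqxx (negPf ij) eq_sym (negPf ij) !mulr0n !mulr1n.
by rewrite subr0 oppr0 sub0r opprK opprB addrC.
Qed.

Lemma ip_o_delta (M : 'M[R]_n) i j : ip_o M (delta_mx i j) = M i j.
Proof.
rewrite ip_oE (bigD1 i)//= (bigD1 j)//= mxE !eqxx mulr1.
rewrite [X in _ + X + _]big1 => [|b bj]; last by rewrite mxE (negPf bj) andbF mulr0.
rewrite [X in _ + X]big1 => [|a ai]; first by rewrite !addr0.
by apply: big1 => b _; rewrite mxE (negPf ai) mulr0.
Qed.

Lemma ip_o_elem (M : 'M[R]_n) i j : antisymmetric_mx M ->
  ip_o M (elem_antisym i j) = 2 * M i j.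
Proof.
move=> /matrixP/(_ j i); rewrite !mxE => aM.
rewrite /elem_antisym ip_oD -[- delta_mx j i]scaleN1r.
have -> : ip_o M (-1 *: delta_mx j i) = - M j i.
  by rewrite /ip_o -scalemxAr mxtraceZ mulN1r -/(ip_o _ _) ip_o_delta.
rewrite ip_o_delta; lra.
Qed.

End elementary_rotation.

Section necessity.
Context {R : realType} {n k : nat}.
Variables (c1 c2 : R -> 'cV[R]_n) (lam : 'rV[R]_k).
Hypotheses (c1_Ck : CkI_mx k c1) (c2_Ck : CkI_mx k c2).
Hypothesis lam_gt0 : forall i, 0 < lam 0 i.
Variable g : R -> 'M[R]_n.
Hypothesis g_H2 : H2_O g.

Lemma critical_energy1 (K : 'M[R]_n) (phi : R -> R) :
  critical_point lam c1 c2 g -> H2 phi -> antisymmetric_mx K ->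
  K *m K *m K = - K ->
  energy1 c1 c2 lam g (fun s => phi s *: (g s *m K)) = 0.
Proof.
move=> crit hphi aK cK.
pose G := rot g K (K *m K) phi.
have G0 : G 0%N 0 = g by apply/funext => s; exact: rot00.
have G1 : G 1%N 0 = (fun s => phi s *: (g s *m K)).
  by apply/funext => s; exact: rot10.
have OG e : `|e| < 1 -> H2_O (G 0%N e).
  move=> _; split; first exact: rot_H2.
  by move=> s Is; exact: rot_orthogonal.
have DG : smooth_H2_jet 1 G.
  by move=> j e _; split; [exact: rot_H2|exact: rot_smooth].
have sG : smooth_H2_family 1 (G 0%N) by exists G.
have := energy_is_derive c1_Ck c2_Ck lam_gt0 ltr01 OG DG.
rewrite G0 G1 => d1.
have d2 := crit 1 (G 0%N) ltr01 OG sG (fun s _ => congr1 (@^~ s) G0).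
by rewrite -(derive_val (is_derive := d1)) (derive_val (is_derive := d2)).
Qed.

(** For V = phi g K the matrix X of the general formula is phi K and its
    derivative is phi' K: the terms in g' cancel, as the logarithmic derivative is
    antisymmetric. *)
Lemma density1_scaled (K : 'M[R]_n) (phi v w : R -> R) s :
  has_H2 phi v w -> antisymmetric_mx K -> unitI s ->
  H2_mx (fun s => phi s *: (g s *m K)) /\
  density1 c1 c2 lam g (fun s => phi s *: (g s *m K)) s =
    phi s * ip_o (force c1 c2 lam g s) K + v s * ip_o (log_deriv g s) K.
Proof.
move=> hphi aK Is; have [hg Og] := g_H2; have gg := Og s Is.
have [hgK dgK] := H2_mx_mul hg (H2_mx_cst K).
set V := (fun s => phi s *: (g s *m K)).
have H a b := has_H2M hphi (H2_has_L2_deriv (hgK a b)).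
have VE a b : (fun s => V s a b) = (fun s => phi s * (g s *m K) a b).
  by apply/funext => t; rewrite mxE.
have hV : H2_mx V by move=> a b; rewrite VE; exact: has_H2_H2 (H a b).
split=> //.
have dcst : derivI_mx (fun=> K) s = 0.
  apply/matrixP => a b; rewrite !mxE.
  exact: has_derivI_val (has_derivI_cst _ _).
have dV : derivI_mx V s = v s *: (g s *m K) + phi s *: (derivI_mx g s *m K).
  have E := dgK s Is; rewrite dcst mulmx0 addr0 in E; rewrite -E.
  apply/matrixP => a b; rewrite [LHS]mxE VE (C1I_derivI (H a b).1 Is).
  have entry (A B : 'M[R]_n) x y : (x *: A + y *: B) a b = x * A a b + y * B a b.
    by rewrite !mxE.
  by rewrite entry; congr (_ + _ * _); rewrite [RHS]mxE.
have XE : (g s)^T *m V s = phi s *: K by rewrite -scalemxAr mulmxA gg mul1mx.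
rewrite density1_tangent// XE; last first.
  by rewrite /antisymmetric_mx linearZ /= aK scalerN.
have -> : (derivI_mx g s)^T *m V s + (g s)^T *m derivI_mx V s = v s *: K.
  have dg : derivI_mx g s = g s *m log_deriv g s.
    by rewrite log_derivE// mulmxA (orthogonal_mul_tr gg) mul1mx.
  rewrite dV mulmxDr -!scalemxAr !mulmxA gg mul1mx -log_derivE//.
  rewrite dg trmx_mul -[_ *m (g s)^T *m g s]mulmxA gg mulmx1.
  by rewrite (log_deriv_antisym g_H2 Is) mulNmx scalerN addrCA addNr addr0.
by rewrite /ip_o -!scalemxAr !mxtraceZ.
Qed.

(** Testing with the generators of the coordinate rotations isolates the entries
    of the equation, each in the weak form of du_bois_reymond. *)
Lemma critical_euler_lagrange : critical_point lam c1 c2 g ->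
  [/\ is_L2_deriv_mx (log_deriv g) (force c1 c2 lam g),
      log_deriv g 0 = 0 & log_deriv g 1 = 0].
Proof.
move=> crit; have cF := force_cont (lam := lam) c1_Ck c2_Ck g_H2.
have OmL := log_deriv_is_L2_deriv g_H2.
suff EL i j : [/\ is_L2_deriv (fun s => log_deriv g s i j)
    (fun s => force c1 c2 lam g s i j), log_deriv g 0 i j = 0
    & log_deriv g 1 i j = 0].
  split; first by move=> i j; have [] := EL i j.
  - by apply/matrixP => i j; rewrite [RHS]mxE; have [] := EL i j.
  - by apply/matrixP => i j; rewrite [RHS]mxE; have [] := EL i j.
apply: du_bois_reymond (cF i j) (OmL i j) _ => phi v w hphi.
have aK := elem_antisymP (R := R) i j.
have := critical_energy1 crit (has_H2_H2 hphi) aK (elem_antisym_cube i j).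
set K := elem_antisym i j in aK *.
have hV := (density1_scaled hphi aK unitI0).1.
have lV := contI_L1 (density1_cont (lam := lam) c1_Ck c2_Ck g_H2.1 hV).
move=> E; rewrite -[RHS](mulr0 2^-1) -E -RintZ//; apply: Rint_eq => s Is.
rewrite (density1_scaled hphi aK Is).2 !ip_o_elem; last 2 first.
- exact: log_deriv_antisym.
- exact: force_antisym.
by field.
Qed.

End necessity.

Unset Implicit Arguments.

Theorem theorem4p1 (R : realType) (n k : nat) (n_gt0 : (0 < n)%N)
    (k_gt0 : (0 < k)%N) (c1 c2 : R -> 'cV[R]_n)
    (c1_Ck : CkI_mx k c1) (c2_Ck : CkI_mx k c2)
    (lam : 'rV[R]_k) (lam_gt0 : forall i, 0 < lam 0 i)
    (g : R -> 'M[R]_n) (g_H2 : H2_O g) :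
  critical_point lam c1 c2 g <->
  (exists W : R -> 'M[R]_n,
     is_L2_deriv_mx (log_deriv g) W /\
     {ae lebesgue_measure, forall s : R, unitI s ->
        W s = diamond (invmx (g s) *m jet c2 s) (flat lam (jet c1 s))}) /\
  log_deriv g 0 = 0 /\ log_deriv g 1 = 0.
Proof.
split=> [/(critical_euler_lagrange c1_Ck c2_Ck lam_gt0 g_H2)[EL Om0 Om1]|].
  split=> //; exists (force c1 c2 lam g); split=> //.
  exact: aeW.
move=> [[W [OmW WF]] [Om0 Om1]].
exact: (euler_lagrange_critical c1_Ck c2_Ck lam_gt0 g_H2 OmW WF Om0 Om1).
Qed.
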